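(* Let $K,L$ be number fields and let $k,l\ge2$ be integers. Then the following are equivalent: (a) The topological dynamical systems $\mathbb D_{K,k}$ and $\mathbb D_{L,l}$ are topologically conjugate. (b) The topological dynamical system $\mathbb D_{L,l}$ is a factor system of $\mathbb D_{K,k}$. (c) $K\cong L$ and $k=l$.
   Context: For a number field $K$ with ring of integers $\mathcal O_K$, the power set $\mathcal P(\mathcal O_K)\cong\{0,1\}^{\mathcal O_K}$ carries the product topology and the translation action of the additive group $\mathcal O_K$. $\mathbb X_{K,k}\subseteq\mathcal P(\mathcal O_K)$ is the closed translation-invariant set of subsets $S\subseteq\mathcal O_K$ such that for every (nonzero) prime ideal $\mathfrak p$ of $\mathcal O_K$, $S$ is disjoint from at least one residue class modulo $\mathfrak p^k$. (Equivalently, for $k\ge2$, it is the closure of the $\mathcal O_K$-orbit of the set $V_{K,k}$ of $x\in\mathcal O_K$ not lying in $\mathfrak p^k$ for any $\mathfrak p$.) $\mathbb D_{K,k}=(\mathbb X_{K,k},\mathcal O_K)$ denotes $\mathbb X_{K,k}$ with the translation action of $\mathcal O_K$. A topological dynamical system $(\mathbb X,G)$ is a compact space $\mathbb X$ with an action of a group $G$ by homeomorphisms (written additively). A morphism $(f,A):(\mathbb X,G)\to(\mathbb Y,H)$ consists of a group homomorphism $A:G\to H$ and a continuous map $f:\mathbb X\to\mathbb Y$ with $f(g+X)=A(g)+f(X)$ for all $g\in G$, $X\in\mathbb X$. It is a factor map if both $A$ and $f$ are surjective; then $(\mathbb Y,H)$ is called a factor system of $(\mathbb X,G)$. It is an isomorphism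 if $A$ is a group isomorphism and $f$ is a homeomorphism; isomorphic systems are called topologically conjugate. *)

(* Defs.v *)
From HB Require Import structures.
From mathcomp Require Import all_boot all_order all_algebra all_field.
From mathcomp Require Import ring_quotient.
From mathcomp Require Import all_classical all_reals.
From mathcomp Require Import topology.
From mathcomp Require Import ring.

Set Implicit Arguments.
Unset Strict Implicit.
Unset Printing Implicit Defensive.

Import Order.TTheory GRing.Theory Num.Theory.

Local Open Scope classical_set_scope.
Local Open Scope ring_scope.

Section RingOfIntegers.
Variable K : fieldExtType rat.

Definition algebraic_integer : {pred K} :=
  fun x => `[< integralOver (intr : int -> K) x >].

Lemma algebraic_integerP x :
  reflect (integralOver (intr : int -> K) x) (x \in algebraic_integer).
Proof. exact: asboolP. Qed.

Lemma algebraic_integer_subring : subring_closed algebraic_integer.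
Proof.
split.
- by apply/algebraic_integerP/integral1.
- move=> x y /algebraic_integerP ? /algebraic_integerP ?.
  by apply/algebraic_integerP/integral_sub.
- move=> x y /algebraic_integerP ? /algebraic_integerP ?.
  by apply/algebraic_integerP/integral_mul.
Qed.

HB.instance Definition _ :=
  GRing.isSubringClosed.Build K algebraic_integer algebraic_integer_subring.

Record int_ring := IntRing {
  int_ring_val :> K;
  _ : int_ring_val \in algebraic_integer }.

HB.instance Definition _ := [isSub for int_ring_val].
HB.instance Definition _ := [Choice of int_ring by <:].
HB.instance Definition _ := [SubChoice_isSubComNzRing of int_ring by <:].

End RingOfIntegers.

Section IdealPower.
Variable R : comNzRingType.

Definition ideal_mul (I J : set R) : set R :=
  [set x | exists s : seq (R * R),
     (forall p, p \in s -> I p.1 /\ J p.2) /\ x = \sum_(p <- s) p.1 * p.2].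

Fixpoint ideal_exp (I : set R) (n : nat) : set R :=
  if n is n'.+1 then ideal_mul I (ideal_exp I n') else setT.

Lemma ideal_expD I n x y :
  ideal_exp I n x -> ideal_exp I n y -> ideal_exp I n (x + y).
Proof.
case: n => //= n [s [sI ->]] [t [tI ->]]; exists (s ++ t).
split; last by rewrite big_cat.
by move=> p; rewrite mem_cat => /orP[/sI|/tI].
Qed.

Lemma ideal_exp_pow I n a x : I a -> ideal_exp I n (a ^+ n * x).
Proof.
move=> Ia; elim: n => //= n IH; exists [:: (a, a ^+ n * x)].
by rewrite big_seq1 exprS mulrA; split=> // p /[!inE] /eqP ->.
Qed.

End IdealPower.

Record dyn_system := DynSystem {
  phase : topologicalType;
  acting_group : zmodType;
  action : acting_group -> phase -> phase;
  phase_compact : compact [set: phase];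
  action0 : forall x, action 0 x = x;
  actionD : forall g h x, action (g + h) x = action g (action h x);
  action_continuous : forall g, continuous (action g) }.

Definition homeomorphism (X Y : topologicalType) (f : X -> Y) :=
  continuous f /\ exists g : Y -> X, [/\ continuous g, cancel f g & cancel g f].

Lemma action_homeomorphism (D : dyn_system) (g : acting_group D) :
  homeomorphism (action g).
Proof.
split; first exact: action_continuous.
exists (action (- g)); split; first exact: action_continuous.
- by move=> x; rewrite -actionD addNr action0.
- by move=> x; rewrite -actionD subrr action0.
Qed.

Definition dyn_morphism (D E : dyn_system) (f : phase D -> phase E)
    (A : {additive acting_group D -> acting_group E}) :=
  continuous f /\ forall g x, f (action g x) = action (A g) (f x).

Definition is_factor_of (E D : dyn_system) :=
  exists (f : phase D -> phase E)
         (A : {additive acting_group D -> acting_group E}),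
    [/\ dyn_morphism f A,
        forall h, exists g, A g = h & forall y, exists x, f x = y].

Definition conjugate (D E : dyn_system) :=
  exists (f : phase D -> phase E)
         (A : {additive acting_group D -> acting_group E}),
    [/\ dyn_morphism f A, bijective A & homeomorphism f].

Definition field_isomorphic (K L : fieldType) :=
  exists f : {rmorphism K -> L}, bijective f.

(* The residue rings of O_K modulo powers of nonzero primes are finite; this is
   what makes the phase space below closed, hence compact. *)
Section FiniteResidues.
Variable K : fieldExtType rat.
Local Notation OK := (int_ring K).

Let cong (m : nat) (x y : OK) := exists z, x - y = m%:R * z.

Lemma common_denominator N n (B : 'M[rat]_(N, n)) :
  exists2 d : int, d != 0 & exists M : 'M[int]_(N, n),
    forall i j, (M i j)%:~R = d%:~R * B i j.
Proof.
pose d := \prod_i \prod_j denq (B i j).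
exists d; first by apply/prodf_neq0 => i _; apply/prodf_neq0 => j _.
suff E i j : exists z : int, z%:~R = d%:~R * B i j.
  exists (\matrix_(i, j) projT1 (cid (E i j))) => i j.
  by rewrite mxE; case: cid.
exists (\prod_(k | k != i) (\prod_l denq (B k l)) *
        (\prod_(l | l != j) denq (B i l)) * numq (B i j)).
have -> : d = (\prod_(k | k != i) \prod_l denq (B k l)) *
    (\prod_(l | l != j) denq (B i l)) * denq (B i j).
  by rewrite /d (bigD1 i) //= (bigD1 j) //= mulrC -mulrA; congr (_ * _); rewrite mulrC.
by rewrite !intrM numqE [B i j * _]mulrC mulrA.
Qed.

Lemma residues_collide m n' : n' = (m.+1 ^ \dim {:K})%N.+1 ->
  forall x : 'I_n' -> OK, exists i j : 'I_n', i != j /\ cong m.+1 (x i) (x j).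
Proof.
move=> En' x; set n := \dim {:K} in En'.
pose B : 'M_(n', n) := \matrix_(i, j) coord (vbasis {:K}) j (val (x i)).
have [d d0 [M EM]] := common_denominator B.
have [L uL [U _ [s _ EMs]]] := int_Smith_normal_form M.
pose y j : OK := \sum_i x i *~ invmx L j i.
have Ex i : x i = \sum_j y j *~ L i j.
  transitivity (\sum_k x k *~ (L *m invmx L) i k).
    rewrite mulmxV // (bigD1 i) //= big1 ?addr0 ?mxE ?eqxx // => k ki.
    by rewrite mxE eq_sym (negPf ki).
  under [RHS]eq_bigr do rewrite /y mulrz_suml.
  rewrite exchange_big /=; apply: eq_bigr => k _.
  rewrite mxE mulrz_sumr; apply: eq_bigr => j _.
  by rewrite -mulrzA mulrC.
have vMz (z : OK) c : int_ring_val (z *~ c) = val z *~ c by exact: (raddfMz val).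
have y0 (j : 'I_n') : (n <= j)%N -> y j = 0.
  move=> nj; apply: val_inj; rewrite rmorph0 (coord_vbasis (memvf (val (y j)))).
  rewrite big1 // => l _; set b := coord _ _ _.
  have d0' : d%:~R != 0 :> rat by rewrite intr_eq0.
  suff -> : b = 0 by rewrite scale0r.
  apply: (mulfI d0'); rewrite mulr0.
  transitivity (((invmx L *m M) j l)%:~R : rat).
    rewrite mxE /b /y !raddf_sum /= mulr_sumr; apply: eq_bigr => i _.
    by rewrite intrM EM mxE vMz raddfMz -mulrzr; ring.
  rewrite EMs -mulmxA mulKmx // mxE big1 // => k _.
  rewrite mxE; case: eqP => [E|_]; last by rewrite mul0r.
  by move: nj; rewrite E leqNgt ltn_ord.
pose c i := [ffun j : 'I_n =>
  inord `|((if insub (val j) is Some j' then L i j' else 0) %% m.+1)%Z| : 'I_m.+1].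
have /injectivePn[i [i' ii' Ec]] : ~~ injectiveb c.
  apply/injectiveP => /leq_card.
  by rewrite card_ord card_ffun !card_ord En' ltnn.
exists i, i'; split=> //.
exists (\sum_j y j *~ ((L i j - L i' j) %/ m.+1)%Z).
rewrite [in LHS]Ex [in X in _ - X]Ex -sumrB mulr_sumr; apply: eq_bigr => j _.
have [jn|/y0 ->] := ltnP j n; last by rewrite !mul0rz subrr mulr0.
rewrite -mulrzBr; have /ffunP/(_ (Ordinal jn)) := Ec; rewrite !ffunE /= insubT //=.
  move=> jn'; have -> : Sub (val j) jn' = j by apply: val_inj.
move=> /(congr1 val) /=.
have lt z : (`|(z %% m.+1)%Z| < m.+1)%N.
  by rewrite -ltz_nat gez0_abs ?modz_ge0 ?ltz_pmod.
rewrite !inordK // => /(congr1 Posz); rewrite !gez0_abs ?modz_ge0 // => /eqP.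
rewrite eqz_mod_dvd => /divzK {1}<-.
by rewrite mulrzA mulr_natl.
Qed.

Lemma finite_residues (m : nat) : (0 < m)%N ->
  exists s : seq OK, forall x, exists2 a, a \in s & cong m x a.
Proof.
case: m => // m _; apply: contrapT => nofin.
have step (s : seq OK) : exists x, forall a, a \in s -> ~ cong m.+1 x a.
  apply: contrapT => nx; apply: nofin; exists s => x.
  apply: contrapT => na; apply: nx; exists x => a sa xa.
  by apply: na; exists a.
have build N : exists2 s : seq OK, size s = N &
    forall i j, (i < j < N)%N -> ~ cong m.+1 s`_i s`_j.
  elim: N => [|N [s sN sP]]; first by exists [::] => // i j; rewrite ltn0 andbF.
  have [x xP] := step s; exists (x :: s); first by rewrite /= sN.
  case=> [|i] [|j] //=; first by move=> jN; apply: xP; apply: mem_nth; rewrite sN.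
  by rewrite !ltnS; apply: sP.
have [s _ sP] := build (m.+1 ^ \dim {:K})%N.+1.
have [i [j [ij Cij]]] := @residues_collide m _ erefl (fun i => s`_i).
case: (ltngtP i j) => [lij|lji|/val_inj E]; last by rewrite E eqxx in ij.
- by apply: (sP i j) => //; rewrite lij ltn_ord.
- apply: (sP j i); first by rewrite lji ltn_ord.
  by case: Cij => z Ez; exists (- z); rewrite mulrN -Ez opprB.
Qed.

Lemma prime_pow_nat (P : prime_idealr OK) k : (exists2 x, x \in P & x != 0) ->
  exists2 m : nat, (0 < m)%N & forall z, ideal_exp [set` P] k (m%:R * z).
Proof.
case=> x Px x0.
suff [m m0 Pm] : exists2 m : nat, (0 < m)%N & (m%:R : OK) \in P.
  exists (m ^ k)%N; first by rewrite expn_gt0 m0.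
  by move=> z; rewrite natrX; apply: ideal_exp_pow.
have /algebraic_integerP [p /monic_neq0 p0] := valP x.
have valZ : (val : OK -> K) \o (intr : int -> OK) =1 (intr : int -> K).
  by move=> z; exact: (rmorph_int (val : {rmorphism OK -> K})).
rewrite -(eq_map_poly valZ) map_poly_comp /root horner_map raddf_eq0; last exact: val_inj.
elim/poly_ind: p p0 => [|q c IH]; first by rewrite eqxx.
rewrite rmorphD rmorphM /= map_polyX map_polyC /= !hornerE.
set r := (X in X * x).
have [->|c0] := eqVneq c 0.
  rewrite polyC0 mulr0z !addr0 => q0 /eqP rx; apply: IH.
    by apply: contraNneq q0 => ->; rewrite mul0r.
  move/(congr1 val): rx; rewrite rmorphM rmorph0 => /eqP.
  rewrite mulf_eq0 => /orP[/eqP r0|/eqP vx0].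
    by apply/eqP/val_inj; rewrite rmorph0.
  by case/eqP: x0; apply: val_inj; rewrite rmorph0.
move=> _; rewrite addrC addr_eq0 => /eqP Ec.
exists `|c|%N; first by rewrite absz_gt0.
have Pc : (c%:~R : OK) \in P by rewrite Ec rpredN idealMr.
case: c Pc {c0 Ec} => [n|n] //=.
by rewrite NegzE rmorphN /= rpredN.
Qed.
End FiniteResidues.

Lemma compact_set_type (T : topologicalType) (A : set T) :
  compact A -> compact [set: set_type A].
Proof.
move=> cA F FF _.
have [|p [Ap Fp]] := cA (set_val @ F) _.
  by apply: (@filterS _ F _ setT) filterT => x _; exact: (set_mem (valP x)).
exists (SigSub (mem_set Ap)); split=> // B C FB.
move=> [_ [[V oV <-] /= Vp VC]].
have [_ [[x Bx <-] Vx]] : set_val @` B `&` V !=set0.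
  apply: Fp; last exact: open_nbhs_nbhs.
  by apply: (@filterS _ F _ B) FB => x Bx; exists x.
by exists x; split=> //; apply: VC.
Qed.

Section FreeSystem.
Variables (K : fieldExtType rat) (k : nat).

Local Notation OK := (int_ring K).

(* A subset of O_K is represented by its characteristic function; bool is
   discrete and {ptws _ -> _} carries the product topology. *)
Definition subsets : Type := {ptws OK -> bool}.
HB.instance Definition _ := Topological.on subsets.

Definition translate (g : OK) (S : subsets) : subsets := fun x => S (x - g).

(* prime_idealr includes properness. *)
Definition free_subsets : set subsets :=
  [set S | forall P : prime_idealr OK, (exists2 x, x \in P & x != 0) ->
     exists a : OK, forall x, ideal_exp [set` P] k (x - a) -> ~~ S x].

Lemma eval_continuous (x : OK) : continuous (fun S : subsets => S x).
Proof. exact: (@proj_continuous OK (fun=> bool) x). Qed.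

Lemma translate_continuous g : continuous (translate g).
Proof.
move=> S; apply/cvg_sup => x; apply/cvg_image.
  by rewrite eqEsubset; split=> // b _; exists (fun=> b).
move=> /= U nU.
have := @eval_continuous (x - g) S U nU.
exists ((fun T : subsets => T x) @^-1` U) => //.
by rewrite image_preimage //; rewrite eqEsubset; split=> // b _; exists (fun=> b).
Qed.

Lemma free_subsets_compact : compact free_subsets.
Proof.
apply: (@subclosed_compact _ _ setT) => //; last first.
  have := @tychonoff OK (fun=> bool) (fun=> setT) (fun=> bool_compact).
  by congr compact; rewrite eqEsubset.
rewrite (_ : free_subsets = \bigcap_(Q in
    [set Q : set OK | exists2 P : prime_idealr OK,
       exists2 x, x \in P & x != 0 & Q = [set` P]])
    [set S | exists a : OK, forall x, ideal_exp Q k (x - a) -> ~~ S x]); last first.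
  rewrite eqEsubset; split=> [S XS _ [P P0 ->]|S XS P P0]; first exact: XS.
  by apply: (XS [set` P]); exists P.
apply: closed_bigI => _ [P /prime_pow_nat -/(_ k) [m m0 mP] ->].
have [s sP] := finite_residues K m0.
rewrite (_ : mkset _ = \big[setU/set0]_(a <- s)
    \bigcap_(x in [set x | ideal_exp [set` P] k (x - a)])
      (fun S : subsets => S x) @^-1` [set false]); last first.
  rewrite -bigcup_seq eqEsubset; split=> S /=.
    case=> a aS; have [b sb [z Ez]] := sP a; exists b => //= x xb.
    apply/negbTE/aS; rewrite (_ : x - a = x - b + m%:R * - z).
      by apply: ideal_expD.
    by rewrite mulrN -Ez opprB addrA subrK.
  by case=> a _ aS; exists a => x /aS /= ->.
apply: closed_bigsetU => a _; apply: closed_bigI => x _.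
apply: (closed_comp (f := fun S : subsets => S x)).
  by move=> S _; exact: eval_continuous.
exact: discrete_closed.
Qed.

Lemma translate_free g (S : free_subsets) : free_subsets (translate g (val S)).
Proof.
move=> P P0; have [a aS] := set_mem (valP S) P P0; exists (a + g) => x.
by rewrite opprD addrCA addrC => /aS.
Qed.

Definition free_translate (g : OK) (S : free_subsets) : free_subsets :=
  SigSub (mem_set (translate_free g S)).

Lemma free_translate0 S : free_translate 0 S = S.
Proof.
by apply: val_inj; apply/funext => x; rewrite /= /translate subr0.
Qed.

Lemma free_translateD g h S :
  free_translate (g + h) S = free_translate g (free_translate h S).
Proof.
by apply: val_inj; apply/funext => x; rewrite /= /translate opprD addrA.
Qed.

Lemma free_translate_continuous g : continuous (free_translate g).
Proof.
apply/continuousP => _ [V oV <-].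
have /continuousP cT : continuous (translate g \o set_val : free_subsets -> subsets).
  move=> S; apply: continuous_comp; last exact: translate_continuous.
  exact: initial_continuous.
exact: cT oV.
Qed.

Definition free_system : dyn_system :=
  @DynSystem (set_type free_subsets) OK free_translate
    (compact_set_type free_subsets_compact)
    free_translate0 free_translateD free_translate_continuous.

End FreeSystem.

(* Main.v *)
Require Import Defs.
From HB Require Import structures.
From mathcomp Require Import all_boot all_order all_algebra all_field.
From mathcomp Require Import ring_quotient.
From mathcomp Require Import all_classical all_reals.
From mathcomp Require Import topology.
From mathcomp Require Import zify ring.

Set Implicit Arguments.
Unset Strict Implicit.
Unset Printing Implicit Defensive.

Import Order.TTheory GRing.Theory Num.Theory.

Local Open Scope classical_set_scope.
Local Open Scope ring_scope.

(**
The proof is combinatorial and avoids entropy. Let [(f, A)] be a factor map from [D_(K,k)] to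
[D_(L,l)]. If [A h = 0] with [h <> 0], then translating a finite set by multiples of [h] pushes it
to infinity without changing its image, so that [f] is constant; hence [A] is bijective, with
inverse [B]. Take a prime [Q] of [O_L] of degree one and unramified over a large rational prime
[r]. If [B (Q^l)] were contained in no [P^k], then far-apart translates of a finite set with
nonempty image could be arranged into an admissible set whose image meets every class modulo
[Q^l], which is impossible. So [B] maps [Q^l] into some [P^k], and because [O_L] is [Z + Q^l] this
gives [B x * B y = B 1 * B (x * y)] modulo infinitely many primes, hence exactly; therefore
[B / B 1] is a field isomorphism. The same arrangement, applied to several finite sets at once,
yields a constant [c] with [f S] contained in [c + A S] for all [S]. Surjectivity of [f] then
shows that every set missing a class modulo each [Q^l] is mapped by [B] to one missing a class
modulo each [P^k], which forces [A (P^k)] into some [Q'^l]. Comparing the cyclic quotients by [P^k] and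
[Q'^l] gives [k = l].
*)

(** Pigeonhole: each [t] rules out at most one index, so having more indices than entries of [s]
    leaves one free. The avoidance arguments below reduce to this. *)
Lemma exists_avoiding (T : eqType) (s : seq T) (bad : T -> nat -> Prop) (N : nat) :
  (size s < N)%N ->
  (forall t i j, t \in s -> (i < N)%N -> (j < N)%N -> bad t i -> bad t j -> i = j) ->
  exists2 j, (j < N)%N & forall t, t \in s -> ~ bad t j.
Proof.
move=> sN inj; apply: contrapT => none.
have H (j : 'I_N) : exists i : 'I_(size s), bad (tnth (in_tuple s) i) j.
  apply: contrapT => nb; apply: none; exists j => // t ts bt; apply: nb.
  by have /tnthP[i Ei] : t \in in_tuple s by []; exists i; rewrite -Ei.
have [g gP] := choice H.
suff /leq_card : injective g by rewrite !card_ord leqNgt sN.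
move=> i j gij; apply: val_inj.
have gPj := gP j; rewrite -gij in gPj.
by apply: inj (gP i) gPj => //; apply: (mem_tnth (g i) (in_tuple s)).
Qed.

(** * Powers of ideals *)

Section Ideals.
Variable R : comNzRingType.
Implicit Types (I J : set R) (u v x y : R).

Definition coprime_elements x y := exists s t, s * x + t * y = 1.

Lemma coprime_elementsMl x y z :
  coprime_elements x z -> coprime_elements y z -> coprime_elements (x * y) z.
Proof.
move=> [s [t E]] [s' [t' E']]; exists (s * s'), (s * x * t' + t * s' * y + t * t' * z).
by rewrite -[RHS](mulr1 1) -{1}E -E'; ring.
Qed.

Lemma coprime_elements_sym x y : coprime_elements x y -> coprime_elements y x.
Proof. by case=> s [t E]; exists t, s; rewrite addrC. Qed.

Lemma coprime_elementsX x y a b :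
  coprime_elements x y -> coprime_elements (x ^+ a) (y ^+ b).
Proof.
have coprimeXl u v n : coprime_elements u v -> coprime_elements (u ^+ n) v.
  move=> uv; elim: n => [|n IH]; first by exists 1, 0; rewrite expr0; ring.
  by rewrite exprS; apply: coprime_elementsMl.
move=> xy; apply/coprimeXl/coprime_elements_sym/coprimeXl.
exact: coprime_elements_sym.
Qed.

Definition is_ideal I :=
  [/\ I 0, forall x y, I x -> I y -> I (x + y) & forall y x, I x -> I (y * x)].

Lemma is_idealN I x : is_ideal I -> I x -> I (- x).
Proof. by move=> [_ _ IM] Ix; rewrite -mulN1r; exact: IM. Qed.

Lemma is_idealB I x y : is_ideal I -> I x -> I y -> I (x - y).
Proof. by move=> iI Ix Iy; case: (iI) => _ ID _; exact: ID (is_idealN iI Iy). Qed.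

Lemma ideal_chinese (T : eqType) (s : seq T) (I : T -> set R) (a : T -> R) :
  (forall t, is_ideal (I t)) -> uniq s ->
  (forall i j, i \in s -> j \in s -> i != j -> exists2 e, I i (1 - e) & I j e) ->
  exists x, forall i, i \in s -> I i (x - a i).
Proof.
move=> idI; elim: s => [|i s IH]; first by exists 0.
move=> /= /andP[is_ us] cm.
have [x0 x0P] : exists x, forall j, j \in s -> I j (x - a j).
  by apply: IH => // j j' js j's; apply: cm; rewrite inE ?js ?j's orbT.
(* [e] is a product of comaximality witnesses for [i]: it is 1 modulo [I i] and 0 modulo the others,
   so adding [e * (a i - x0)] corrects [x0] at [i] alone. *)
have [e ie je] : exists2 e, I i (1 - e) & forall j, j \in s -> I j e.
  suff ex (s' : seq T) : {subset s' <= s} -> exists2 e, I i (1 - e) & forall j, j \in s' -> I j e.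
    exact: ex.
  elim: s' => [_|j s' IH' sub].
    by exists 1 => //; rewrite subrr; case: (idI i).
  have [|e ie je] := IH'; first by move=> j' j's'; apply: sub; rewrite inE j's' orbT.
  have js : j \in s by apply: sub; rewrite mem_head.
  have ij : i != j by apply: contraNneq is_ => ->.
  have [e' ie' je'] : exists2 e, I i (1 - e) & I j e.
    by apply: cm => //; rewrite inE ?eqxx ?js ?orbT.
  exists (e' * e).
    have -> : 1 - e' * e = (1 - e') + e' * (1 - e) by ring.
    by case: (idI i) => _ ID IM; apply: ID => //; apply: IM.
  move=> j'; rewrite inE => /predU1P[->|/je]; last by case: (idI j') => _ _; apply.
  by rewrite mulrC; case: (idI j) => _ _; apply.
exists (x0 + e * (a i - x0)) => j; rewrite inE => /predU1P[->|js].
  have -> : x0 + e * (a i - x0) - a i = (x0 - a i) * (1 - e) by ring.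
  by case: (idI i) => _ _; apply.
have -> : x0 + e * (a i - x0) - a j = (x0 - a j) + (a i - x0) * e by ring.
by case: (idI j) => _ ID IM; apply: ID; [exact: x0P|apply/IM/je].
Qed.

Lemma ideal_expM I n y x : ideal_exp I n x -> ideal_exp I n (y * x).
Proof.
elim: n x => //= n IH _ [s [sI ->]]; exists [seq (p.1, y * p.2) | p <- s]; split.
  by move=> _ /mapP[p /sI[? ?] ->]; split=> //; apply: IH.
by rewrite big_map mulr_sumr; apply: eq_bigr => p _ /=; ring.
Qed.

Lemma ideal_exp_ideal I n : is_ideal (ideal_exp I n).
Proof.
split; [|by move=> x y; apply: ideal_expD|by move=> y x; apply: ideal_expM].
by case: n => //= n; exists [::]; rewrite big_nil.
Qed.

Lemma ideal_expB I n x y : ideal_exp I n x -> ideal_exp I n y -> ideal_exp I n (x - y).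
Proof. exact: is_idealB (ideal_exp_ideal I n). Qed.

Lemma ideal_expS_mul I n a x : I a -> ideal_exp I n x -> ideal_exp I n.+1 (a * x).
Proof.
move=> Ia Ix; exists [:: (a, x)]; split; last by rewrite big_seq1.
by move=> p /[!inE] /eqP ->.
Qed.

Lemma ideal_exp_anti I m n x : (m <= n)%N -> ideal_exp I n x -> ideal_exp I m x.
Proof.
move=> /subnK <-; elim: (n - m)%N x => // j IH _ [s [sI ->]].
rewrite big_seq; elim/big_ind: _ => [||p /sI[_ /IH Ip]].
- by case: (ideal_exp_ideal I m).
- by move=> ? ?; apply: ideal_expD.
- exact: ideal_expM.
Qed.

Lemma ideal_expX I n a x : I a -> ideal_exp I n (x * a ^+ n).
Proof. by rewrite mulrC; apply: ideal_exp_pow. Qed.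

Section PrimeIdeal.
Variable P : prime_idealr R.

Lemma ideal_exp_sub n x : (0 < n)%N -> ideal_exp [set` P] n x -> x \in P.
Proof.
case: n => // n _ [s [sP ->]]; rewrite big_seq.
by elim/big_ind: _ => [|? ?|p /sP[Pp _]]; rewrite ?rpred0 //;
  [exact: rpredD|rewrite mulrC idealMr].
Qed.

Lemma prime_ideal1 : (1 \in P) = false.
Proof. exact: idealr1. Qed.

Lemma prime_idealX n x : x ^+ n \in P -> x \in P.
Proof.
elim: n => [|n IH]; first by rewrite expr0 prime_ideal1.
by rewrite exprS prime_idealrM => /orP[].
Qed.

End PrimeIdeal.

Lemma ideal_exp_comaximal (P Q : prime_idealr R) m n u :
  u \in P -> 1 - u \in Q ->
  exists2 e, ideal_exp [set` P] m (1 - e) & ideal_exp [set` Q] n e.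
Proof.
move=> uP uQ; have [|s [t E]] := @coprime_elementsX u (1 - u) m n.
  by exists 1, 1; ring.
exists (t * (1 - u) ^+ n); last exact: ideal_expX.
have -> : 1 - t * (1 - u) ^+ n = s * u ^+ m by apply/eqP; rewrite subr_eq E.
exact: ideal_expX.
Qed.

End Ideals.

(** * Prime ideals of rings of integers *)

Section IntRing.
Variable K : fieldExtType rat.
Local Notation OK := (int_ring K).

Lemma natr_fieldExt_eq0 n : ((n%:R : K) == 0) = (n == 0)%N.
Proof. by rewrite -scaler_nat scaler_eq0 oner_eq0 orbF Num.Theory.pnatr_eq0. Qed.

Lemma intr_fieldExt_eq0 (z : int) : ((z%:~R : K) == 0) = (z == 0).
Proof.
case: z => n; first by rewrite -pmulrn natr_fieldExt_eq0.
by rewrite NegzE mulrNz oppr_eq0 -pmulrn natr_fieldExt_eq0.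
Qed.

Lemma int_ring_val_natr n : val (n%:R : OK) = n%:R.
Proof. exact: (rmorph_nat (val : {rmorphism OK -> K})). Qed.

Lemma int_ring_val_intr z : val (z%:~R : OK) = z%:~R.
Proof. exact: (rmorph_int (val : {rmorphism OK -> K})). Qed.

Lemma int_ring_natr_eq0 n : ((n%:R : OK) == 0) = (n == 0)%N.
Proof. by rewrite -(inj_eq val_inj) int_ring_val_natr rmorph0 natr_fieldExt_eq0. Qed.

Lemma int_ring_mulf_eq0 (x y : OK) : (x * y == 0) = (x == 0) || (y == 0).
Proof. by rewrite -!(inj_eq val_inj) rmorphM rmorph0 mulf_eq0. Qed.

Lemma int_ring_intr_inj : injective (intr : int -> OK).
Proof.
move=> a b /(congr1 val) /eqP; rewrite !int_ring_val_intr -subr_eq0 -intrB.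
by rewrite intr_fieldExt_eq0 subr_eq0 => /eqP.
Qed.

Lemma int_ring_mulnI (n : nat) (x y : OK) : (0 < n)%N -> n%:R * x = n%:R * y -> x = y.
Proof.
move=> n0 /eqP; rewrite -subr_eq0 -mulrBr int_ring_mulf_eq0 int_ring_natr_eq0.
by rewrite -[n]prednK //= subr_eq0 => /eqP.
Qed.

Lemma int_poly_root (x : K) : exists2 g : {poly int}, g != 0 &
  root (map_poly intr g) x.
Proof.
have /polyOver1P[p Ep] := minPolyOver 1%AS x.
have [q [a a0 Eq]] := rat_poly_scale p; exists q.
  apply: contra_eq_neq Ep => q0.
  by rewrite Eq q0 rmorph0 scaler0 rmorph0 monic_neq0 ?monic_minPoly.
have := root_minPoly 1%AS x; rewrite Ep Eq map_polyZ rootZ ?fmorph_eq0 ?invr_eq0 ?intr_eq0 //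
  -map_poly_comp.
by rewrite (eq_map_poly (g := intr)) // => z; apply: (rmorph_int (in_alg K)).
Qed.

Lemma int_ring_multiple (x : K) : exists2 d : nat, (0 < d)%N &
  exists z : OK, val z = d%:R * x.
Proof.
have [g g0 gx] := int_poly_root x.
pose n := (size g).-1; pose c := lead_coef g.
have sg : size g = n.+1 by rewrite prednK // lt0n size_poly_eq0.
have cZ : val (c%:~R : OK) = c%:~R by exact: int_ring_val_intr.
have n0 : (0 < n)%N.
  rewrite lt0n; apply: contraL gx => /eqP n0; rewrite /root.
  have /eqP/size_poly1P[b b0 ->] : size g = 1%N by rewrite sg n0.
  by rewrite map_polyC /= hornerC intr_fieldExt_eq0.
suff H : c%:~R * x \in @algebraic_integer K.
  exists `|c|%N; first by rewrite absz_gt0 lead_coef_eq0.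
  have [s ->] : exists s : bool, (`|c|%N%:R : K) = (-1) ^+ s * c%:~R.
    case: (c) => m; first by exists false; rewrite expr0 mul1r.
    by exists true; rewrite NegzE abszN mulrNz expr1 mulrN mulN1r opprK.
  by exists ((-1) ^+ s * IntRing H); rewrite rmorphM rmorphXn rmorphN1 mulrA.
(* [q] is [c ^ n.-1 * g(X / c)]: monic with integer coefficients, and zero at [c * x]. *)
pose q := \poly_(i < n.+1) (if i == n then 1 else g`_i * c ^+ (n.-1 - i)).
apply/algebraic_integerP; exists q.
  rewrite monicE lead_coefE.
  have -> : size q = n.+1 by rewrite size_poly_eq // eqxx oner_eq0.
  by rewrite coef_poly ltnSn eqxx.
have Eq : map_poly intr q = \poly_(i < n.+1) (if i == n then 1 else g`_i * c ^+ (n.-1 -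
  i))%:~R :> {poly K}.
  by apply/polyP => i; rewrite coef_map !coef_poly; case: ifP.
rewrite /root Eq horner_poly.
have : (map_poly intr g : {poly K}) = \poly_(i < n.+1) (g`_i)%:~R.
  apply/polyP => i; rewrite coef_map !coef_poly; case: ltnP => // ni.
  by rewrite nth_default // sg.
move=> Eg; rewrite Eg /root horner_poly in gx.
have -> : \sum_(i < n.+1) (if i == n :> nat then 1 else g`_i * c ^+ (n.-1 -
  i))%:~R * (c%:~R * x) ^+ i = c%:~R ^+ n.-1 * \sum_(i < n.+1) (g`_i)%:~R * x ^+ i.
  rewrite mulr_sumr; apply: eq_bigr => i _; rewrite exprMn !mulrA; congr (_ * _).
  case: eqP => [->|/eqP ni].
    have -> : g`_n = c by rewrite /c lead_coefE.
    by rewrite mul1r -{1}(prednK n0) exprSr.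
  have lin : (i <= n.-1)%N by have := ltn_ord i; lia.
  by rewrite -[in RHS](subnK lin) exprD rmorphM rmorphXn /=; ring.
by rewrite (eqP gx) mulr0.
Qed.

(** Cancelling factors [x] from an integer relation satisfied by [x] leaves a nonzero constant term,
    which is a multiple of [x]; up to sign it is the wanted [c]. *)
Lemma int_ring_dvd_nat (x : OK) : x != 0 -> exists2 c : nat, (0 < c)%N &
  exists w, c%:R = w * x.
Proof.
move=> x0; have [g g0] := int_poly_root (val x).
have valZ : (val : OK -> K) \o (intr : int -> OK) =1 (intr : int -> K).
  exact: int_ring_val_intr.
rewrite -(eq_map_poly valZ) map_poly_comp /root horner_map -[0](rmorph0 (val :
  {rmorphism OK -> K})).
rewrite (inj_eq val_inj).
elim/poly_ind: g g0 => [|q c IH]; first by rewrite eqxx.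
rewrite rmorphD rmorphM /= map_polyX map_polyC /= !hornerE => qc0.
set y := (X in X * x); have [E|c0] := eqVneq c 0.
  rewrite E mulr0z addr0 int_ring_mulf_eq0 (negPf x0) orbF; apply: IH.
  by apply: contraNneq qc0 => ->; rewrite E mul0r add0r.
rewrite addrC addr_eq0 => /eqP Ec.
exists `|c|%N; first by rewrite absz_gt0.
case: c Ec {c0 qc0} => n Ec; first by exists (- y); rewrite mulNr -Ec.
by exists y; rewrite NegzE abszN; apply/oppr_inj; rewrite -Ec NegzE mulrNz.
Qed.

Section Prime.
Variable P : prime_idealr OK.

Definition nonzero_ideal := exists2 x, x \in P & x != 0.

Lemma nonzero_ideal_nat m : (0 < m)%N -> m%:R \in P -> nonzero_ideal.
Proof. by move=> m0 mP; exists m%:R; rewrite // int_ring_natr_eq0 -lt0n. Qed.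

(** Finitely many residues force two powers of [x] to agree modulo [P]; cancelling the smaller
    power, which lies outside [P], leaves [1 - x ^ d] in [P] with [d > 0]. *)
Lemma prime_ideal_maximal x : nonzero_ideal -> x \notin P -> exists y, 1 - y * x \in P.
Proof.
move=> P0 xP; have [m m0 mP] := prime_pow_nat 1 P0.
case: m m0 mP => // m _ mP.
have [i [j [ij [z Ez]]]] := @residues_collide K m _ erefl (fun i => x ^+ i).
have : x ^+ i - x ^+ j \in P by rewrite Ez; exact: (ideal_exp_sub (ltnSn 0) (mP z)).
have done a b : (a < b)%N -> x ^+ a - x ^+ b \in P -> exists y, 1 - y * x \in P.
  move=> ab; have -> : x ^+ a - x ^+ b = x ^+ a * (1 - x ^+ (b - a).-1 * x).
    by rewrite -exprSr prednK ?subn_gt0 // mulrBr mulr1 -exprD subnKC // ltnW.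
  rewrite prime_idealrM => /orP[/prime_idealX|]; first by rewrite (negPf xP).
  by exists (x ^+ (b - a).-1).
case: (ltngtP i j) => [ij'|ji|/val_inj E]; last by rewrite E eqxx in ij.
  exact: done.
by rewrite -rpredN opprB; apply: done.
Qed.

Lemma prime_ideal_dvdn r n : prime r -> r%:R \in P -> (n%:R \in P) = (r %| n)%N.
Proof.
move=> pr rP; apply/idP/idP => [nP|/dvdnP[q ->]]; last by rewrite natrM idealMr.
rewrite -[(_ %| _)%N]negbK -prime_coprime //; apply/negP => co.
have n0 : (0 < n)%N by case: n co {nP} => // ; rewrite /coprime gcdn0; case: eqP pr => // ->.
have [u v E _] := egcdnP r n0; move/eqP: co; rewrite gcdnC => co; rewrite co in E.
have : (u * n)%N%:R - (v * r)%N%:R \in P by rewrite rpredB // natrM idealMr.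
by rewrite E natrD addrAC subrr add0r prime_ideal1.
Qed.

End Prime.

Lemma distinct_prime_ideals (P Q : prime_idealr OK) : nonzero_ideal P -> nonzero_ideal Q ->
  ~ P =i Q -> exists2 u, u \in P & 1 - u \in Q.
Proof.
move=> P0 Q0 PQ; suff [u uP uQ] : exists2 u, u \in P & u \notin Q.
  by have [y yQ] := prime_ideal_maximal Q0 uQ; exists (y * u) => //; apply: idealMr.
apply: contrapT => H; apply: PQ.
have sub x : x \in P -> x \in Q.
  by move=> xP; apply/negPn/negP => xQ; apply: H; exists x.
move=> x; apply/idP/idP => [/sub//|xQ]; apply/negPn/negP => xP.
have [y /sub] := prime_ideal_maximal P0 xP.
have /(idealMr y) yxQ := xQ; move=> /(rpredD yxQ).
by rewrite addrC subrK prime_ideal1.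
Qed.

(** * Counting the primes above an integer *)

Section DistinctPrimes.
Variables (t : nat) (P : 'I_t -> prime_idealr OK).
Hypothesis P0 : forall i, nonzero_ideal (P i).
Hypothesis Pdist : forall i j, i != j -> ~ P i =i P j.

Lemma prime_power_chinese n (a : 'I_t -> OK) :
  exists x, forall i, ideal_exp [set` P i] n (x - a i).
Proof.
have [||i j _ _ ij|x xP] := @ideal_chinese OK _ (enum 'I_t) (fun i => ideal_exp [set` P i] n) a.
- by move=> i; apply: ideal_exp_ideal.
- exact: enum_uniq.
- have [u uP uQ] := distinct_prime_ideals (P0 i) (P0 j) (Pdist ij).
  exact: ideal_exp_comaximal uP uQ.
- by exists x => i; apply: xP; rewrite mem_enum.
Qed.

(* By the Chinese remainder theorem, [d ^ t] elements are pairwise incongruent modulo [m]. *)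
Lemma distinct_primes_count m d : (0 < m)%N -> (forall i, m%:R \in P i) ->
  (forall i c, (0 < c < d)%N -> c%:R \notin P i) -> (d ^ t <= m ^ \dim {:K})%N.
Proof.
case: m => // m _ mP dP; rewrite leqNgt; apply/negP => lt.
have [X XP] := choice (fun v : {ffun 'I_t -> 'I_d} =>
  prime_power_chinese 1 (fun i => (v i)%:R)).
have cardV : #|{: {ffun 'I_t -> 'I_d}}| = (d ^ t)%N by rewrite card_ffun !card_ord.
pose V (i : 'I_(m.+1 ^ \dim {:K}).+1) : {ffun 'I_t -> 'I_d} :=
  enum_val (cast_ord (esym cardV) (widen_ord lt i)).
have [i [j [ij [z Ez]]]] := residues_collide erefl (fun i => X (V i)).
case/negP: ij; apply/eqP/val_inj; suff E : V i = V j.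
  by have /(congr1 val) := cast_ord_inj (enum_val_inj E).
apply/ffunP => a; apply: val_inj => /=.
have /(ideal_exp_sub (ltnSn 0)) h1 := XP (V i) a.
have /(ideal_exp_sub (ltnSn 0)) h2 := XP (V j) a.
have h3 : X (V i) - X (V j) \in P a by rewrite Ez mulrC; exact: idealMr (mP a).
have h : ((V i a)%:R : OK) - (V j a)%:R \in P a.
  rewrite (_ : _ - _ = X (V i) - X (V j) - (X (V i) - (V i a)%:R - (X (V j) - (V j a)%:R))).
    by rewrite rpredB // rpredB.
  by ring.
have [lij|lji|//] := ltngtP (V i a) (V j a).
- have /dP/negP : (0 < V j a - V i a < d)%N.
    by rewrite subn_gt0 lij (leq_ltn_trans (leq_subr _ _)).
  by move=> /(_ a); case; rewrite natrB ?(ltnW lij) // -rpredN opprB.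
- have /dP/negP : (0 < V i a - V j a < d)%N.
    by rewrite subn_gt0 lji (leq_ltn_trans (leq_subr _ _)).
  by move=> /(_ a); case; rewrite natrB ?(ltnW lji).
Qed.
End DistinctPrimes.

(** If no family were complete, families could be extended forever, against the bound
    [2 ^ t <= m ^ \dim {:K}] obtained by counting with [d = 2]. *)
Lemma prime_ideals_above m : (0 < m)%N ->
  exists (t : nat) (P : 'I_t -> prime_idealr OK),
    [/\ forall i, m%:R \in P i, forall i j, i != j -> ~ P i =i P j &
        forall Q : prime_idealr OK, m%:R \in Q -> exists i, Q =i P i].
Proof.
move=> m0; apply: contrapT => none.
pose fam t := exists P : 'I_t -> prime_idealr OK,
  (forall i, m%:R \in P i) /\ forall i j, i != j -> ~ P i =i P j.
have famS t : fam t -> fam t.+1.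
  move=> [P [mP dP]]; apply: contrapT => nf; apply: none; exists t, P; split=> // Q mQ.
  apply: contrapT => nQ; apply: nf.
  exists (fun i => if unlift ord0 i is Some j then P j else Q); split=> [i|i j].
    by case: unlift.
  case: (unliftP ord0 i) => [i'|] ->; case: (unliftP ord0 j) => [j'|] -> //= ne.
  - by apply: dP; apply: contraNneq ne => ->.
  - by move=> E; apply: nQ; exists i' => x; rewrite E.
  - by move=> E; apply: nQ; exists j'.
have famT t : fam t.
  elim: t => [|t /famS//].
  by exists (fun i : 'I_0 => False_rect _ (notF (ltn_ord i))); split=> -[].
have [P [mP dP]] := famT (m ^ \dim {:K})%N.+1.
have h1 i c : (0 < c < 2)%N -> c%:R \notin P i by case: c => [|[|c]]; rewrite ?prime_ideal1.
have := distinct_primes_count (fun i => nonzero_ideal_nat m0 (mP i)) dP m0 mP h1.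
by rewrite leqNgt (leq_trans (ltn_expl _ (ltnSn 1))) // leq_exp2l.
Qed.

(** Counting with [d = r] is possible because [P i] contains no positive integer below [r]; it gives
    [r ^ t <= r ^ \dim {:K}]. *)
Lemma prime_ideals_above_prime r : prime r ->
  exists (t : nat) (P : 'I_t -> prime_idealr OK),
    [/\ (t <= \dim {:K})%N, forall i, r%:R \in P i, forall i j, i != j -> ~ P i =i P j &
        forall Q : prime_idealr OK, r%:R \in Q -> exists i, Q =i P i].
Proof.
move=> pr; have [t [P [rP dP allP]]] := prime_ideals_above (prime_gt0 pr).
exists t, P; split=> //; rewrite -(leq_exp2l _ _ (prime_gt1 pr)).
apply: (distinct_primes_count _ dP (prime_gt0 pr) rP) => [i|i c /andP[c0 cr]].
  exact: nonzero_ideal_nat (prime_gt0 pr) (rP i).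
by rewrite (prime_ideal_dvdn _ pr) // gtnNdvd.
Qed.

Lemma eq_ideal_exp (P Q : prime_idealr OK) n : P =i Q ->
  ideal_exp [set` P] n = ideal_exp [set` Q] n.
Proof. by move=> PQ; congr ideal_exp; apply/seteqP; split=> x /=; rewrite PQ. Qed.

End IntRing.

(** * Building admissible sets *)

Section Placement.
Variable K : fieldExtType rat.
Local Notation OK := (int_ring K).

Definition finite_subset (T : seq OK) : subsets K := fun x => x \in T.

Lemma prime_power_cancel (P : prime_idealr OK) k r j x : prime r -> r%:R \in P ->
  (0 < j < r)%N -> ideal_exp [set` P] k (j%:R * x) -> ideal_exp [set` P] k x.
Proof.
move=> pr rP /andP[j0 jr] Pjx.
have jP : j%:R \notin P by rewrite (prime_ideal_dvdn _ pr rP) gtnNdvd.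
have [y yP] := prime_ideal_maximal (nonzero_ideal_nat (prime_gt0 pr) rP) jP.
have [|u [v E]] := @coprime_elementsX _ (1 - y * j%:R) (y * j%:R) k 1.
  by exists 1, 1; ring.
have -> : x = u * x * (1 - y * j%:R) ^+ k + v * y * (j%:R * x).
  by rewrite -[LHS]mul1r -[in LHS]E; ring.
by apply: ideal_expD; [apply: ideal_expX|apply: ideal_expM].
Qed.

(** * Avoiding cosets of prime powers within a set stable under addition and natural multiples *)

Section Outside.
Variables (k r t : nat) (P : 'I_t -> prime_idealr OK) (M : set OK) (J : pred 'I_t).
Hypotheses (pr : prime r) (rP : forall i, r%:R \in P i).
Hypotheses (M0 : M 0) (MD : forall x y, M x -> M y -> M (x + y)).
Hypothesis Mn : forall n x, M x -> M (n%:R * x).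
Hypothesis MJ : forall i, J i -> exists2 m, M m & ~ ideal_exp [set` P i] k m.

Let Pk i := ideal_exp [set` P i] k.

(** Two values [i < j < r] failing the same condition would put [(j - i) * m], hence [m], in the
    prime power, as [j - i] is invertible modulo it. So each condition excludes at most one [j]
    below [r]. *)
Lemma exists_multiple_outside (E : seq ('I_t * OK)) m x : (size E < r)%N ->
  (forall e, e \in E -> ~ Pk e.1 m) -> exists j :
    nat, forall e, e \in E -> ~ Pk e.1 (x + j%:R * m + e.2).
Proof.
move=> Er Em.
have [|e i j eE ir jr bi bj|j _ jP] :=
    @exists_avoiding _ E (fun e j => Pk e.1 (x + j%:R * m + e.2)) r => //; last by exists j.
wlog ij : i j ir jr bi bj / (i < j)%N.
  by move=> H; case: (ltngtP i j) => [|/(H j i)->|] //; apply: H.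
case: (Em e eE); apply: (prime_power_cancel (j := (j - i)%N) pr (rP _)).
  by rewrite subn_gt0 ij (leq_ltn_trans (leq_subr _ _)).
have := ideal_expB bj bi; congr (ideal_exp _ _ _).
by rewrite natrB ?(ltnW ij) //; ring.
Qed.

(** Primes are treated one at a time: if the current [m] lies in the new prime power, take [m'] in
    [M] outside it. Then [m' + j * m] stays outside it for every [j], and outside the earlier ones
    for a suitable [j]. *)
Lemma exists_common_outside : (t < r)%N ->
  exists2 m, M m & forall i, J i -> ~ Pk i m.
Proof.
move=> tr.
suff ex (L : seq 'I_t) : (size L < r)%N -> (forall i, i \in L -> J i) ->
    exists2 m, M m & forall i, i \in L -> ~ Pk i m.
  have [||m Mm mP] := ex (enum J).
  - by rewrite -cardE (leq_ltn_trans (max_card _)) // card_ord.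
  - by move=> i; rewrite mem_enum.
  - by exists m => // i Ji; apply: mP; rewrite mem_enum.
elim: L => [|i L IH] /= Lr LJ; first by exists 0.
have [||m Mm mL] := IH; first exact: ltnW.
  by move=> j jL; apply: LJ; rewrite inE jL orbT.
have [Pm|nPm] := pselect (Pk i m); last first.
  by exists m => // j; rewrite inE => /predU1P[->|/mL].
have [m' Mm' nPm'] := MJ (LJ i (mem_head _ _)).
have [||j jP] := @exists_multiple_outside [seq (a, 0) | a <- L] m m'.
- by rewrite size_map ltnW.
- by move=> _ /mapP[a aL ->]; apply: mL.
exists (m' + j%:R * m); first by apply: MD => //; apply: Mn.
move=> a; rewrite inE => /predU1P[->|aL].
  move=> Pa; apply: nPm'.
  have := ideal_expB Pa (ideal_expM j%:R Pm); congr (ideal_exp _ _ _).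
  by rewrite addrK.
have := jP (a, 0); rewrite /= addr0; apply.
by apply/mapP; exists a.
Qed.

Lemma exists_outside_cosets (S : seq OK) x : (t < r)%N -> (t * size S < r)%N ->
  exists2 m, M m & forall i s, J i -> s \in S -> ~ Pk i (x + m + s).
Proof.
move=> tr tSr; have [m Mm mP] := exists_common_outside tr.
have [||j jP] := @exists_multiple_outside [seq (i, s) | i <- enum J, s <- S] m x.
- rewrite size_allpairs (leq_ltn_trans _ tSr) // leq_mul2r.
  by rewrite -cardE (leq_trans (max_card _)) ?orbT // card_ord.
- by move=> _ /allpairsP[[i s] [/= iJ sS ->]] /=; apply: mP; rewrite mem_enum in iJ.
exists (j%:R * m) => [|i s Ji sS]; first exact: Mn.
apply: (jP (i, s)); apply/allpairsP; exists (i, s) => /=.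
by rewrite mem_enum.
Qed.

End Outside.

(* Primes above [r] are dealt with by hypothesis, the other primes whose norm may not exceed the
   number of points by the Chinese remainder theorem, and the remaining ones by counting. *)
Lemma place_pieces k r e n (T : 'I_n -> seq OK) (x : 'I_n -> OK) (D : seq OK) :
  prime r -> (k <= e)%N -> (0 < k)%N ->
  (forall i, free_subsets k (finite_subset (T i))) ->
  (forall (P : prime_idealr OK) i s, r%:R \in P -> s \in T i ->
     ~ ideal_exp [set` P] k (x i + s)) ->
  exists y : 'I_n -> OK,
    [/\ forall i, exists z, y i - x i = r%:R ^+ e * z,
        free_subsets k (finite_subset (flatten [seq [seq y i + s | s <- T i] | i <- enum 'I_n])) &
        forall i j, i != j -> y i - y j \notin D].
Proof.
move=> pr ke k0 Tfree xP.
pose N := (\sum_(i < n) size (T i))%N; pose m := N`!.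
have m0 : (0 < m)%N by apply: fact_gt0.
have [t [Q [mQ dQ allQ]]] := prime_ideals_above K m0.
have Q0 i := nonzero_ideal_nat m0 (mQ i).
have inv (j : 'I_t) : exists v :
  OK, r%:R \notin Q j -> ideal_exp [set` Q j] k (1 - v * r%:R ^+ e).
  have [rQ|rQ] := boolP (r%:R \in Q j); first by exists 0.
  have [u uQ] := prime_ideal_maximal (Q0 j) rQ.
  have [|a [b E]] := @coprime_elementsX _ (1 - u * r%:R) (u * r%:R) k e.
    by exists 1, 1; ring.
  exists (b * u ^+ e) => _; have -> : 1 - b * u ^+ e * r%:R ^+ e = a * (1 - u * r%:R) ^+ k.
    by apply/eqP; rewrite subr_eq -mulrA -exprMn E.
  exact: ideal_expX.
have [v vP] := choice inv.
have miss (i : 'I_n) (j : 'I_t) : exists a :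
  OK, forall s, s \in T i -> ~ ideal_exp [set` Q j] k (s - a).
  have [a aP] := Tfree i (Q j) (Q0 j); exists a => s sT /aP.
  by rewrite /finite_subset sT.
have [a aP] := choice (fun ij : 'I_n * 'I_t => miss ij.1 ij.2).
(* Where [r] is outside [Q j], this makes [y0 i] congruent to [- a (i, j)]: the class missed by
   [T i] is moved to 0. *)
have [w wP] := choice (fun i => prime_power_chinese Q0 dQ k (fun j => v j * (- a (i, j) - x i))).
pose y0 i := x i + r%:R ^+ e * w i.
pose c := (r ^ e * m ^ k)%N.
have c0 : (0 < c)%N by rewrite muln_gt0 !expn_gt0 m0 prime_gt0.
have y0Q i j s : r%:R \notin Q j -> s \in T i -> ~ ideal_exp [set` Q j] k (y0 i + s).
  move=> rQ sT Ps; apply: (aP (i, j) s sT).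
  have h1 := ideal_expM (r%:R ^+ e) (wP i j).
  have h2 := ideal_expM (- a (i, j) - x i) (vP j rQ).
  have := ideal_expB Ps (ideal_expB h1 h2); congr (ideal_exp _ _ _).
  by rewrite /y0 /=; ring.
(* Multiples of [c] vanish modulo the prime powers already treated. For given [i != j], each
   difference in [D] arises for at most one [Z], so a further shift by [c * i * Z] separates the
   pieces. *)
pose E := [seq (i, d) | i <- enum {: 'I_n * 'I_n}, d <- D].
have [|[[i j] d] p q eE _ _|Z _ ZP] := @exists_avoiding _ E
  (fun e Z => e.1.1 != e.1.2 /\ y0 e.1.1 - y0 e.1.2 + c%:R * ((e.1.1)%:R -
    (e.1.2)%:R) * Z%:R = e.2) (size E).+1 => //=.
  move=> [ij <-] [_] /eqP; rewrite (inj_eq (addrI _)) -subr_eq0 -mulrBr.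
  rewrite !int_ring_mulf_eq0 int_ring_natr_eq0 eqn0Ngt c0 /= !subr_eq0.
  have nI (h l : nat) : (h%:R == l%:R :> OK) =
    (h == l) by rewrite !pmulrn (inj_eq (@int_ring_intr_inj K)).
  by rewrite !nI (negPf (ij : i != j :> nat)) => /eqP.
pose y i := y0 i + c%:R * (i%:R * Z%:R).
have yP (P : prime_idealr OK) i s :
  nonzero_ideal P -> s \in T i -> (m%:R \in P) || (r%:R \in P) ->
    ~ ideal_exp [set` P] k (y i + s).
  move=> P0 sT; case: (boolP (r%:R \in P)) => [rP _|rP].
    have h u : ideal_exp [set` P] k (r%:R ^+ e * u).
      by rewrite mulrC; apply/(ideal_exp_anti ke)/ideal_expX.
    move=> yiP; apply: (xP P i s rP sT).
    have := ideal_expB yiP (h (w i + (m ^ k)%:R * (i%:R * Z%:R))); congr (ideal_exp _ _ _).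
    by rewrite /y /y0 /c natrM natrX; ring.
  rewrite orbF => /allQ[j PQ]; rewrite PQ in rP; rewrite (eq_ideal_exp _ PQ).
  have h u : ideal_exp [set` Q j] k (m%:R ^+ k * u).
    by rewrite mulrC; apply/ideal_expX/mQ.
  move=> yiP; apply: (y0Q i j s rP sT).
  have := ideal_expB yiP (h (r%:R ^+ e * (i%:R * Z%:R))); congr (ideal_exp _ _ _).
  by rewrite /y /c natrM !natrX; ring.
exists y; split.
- by move=> i; exists (w i + (m ^ k)%:R * (i%:R * Z%:R)); rewrite /y /y0 /c natrM natrX; ring.
- move=> P P0; have [mrP|] := boolP ((m%:R \in P) || (r%:R \in P)).
    exists 0 => z; rewrite subr0 => Pz; apply/negP => /flattenP[_ /mapP[i _ ->]] /mapP[s sT Ez].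
    by apply: (yP P i s P0 sT mrP); rewrite -Ez.
  rewrite negb_or => /andP[mP _].
  set F := flatten _.
  have sF : size F = N.
    by rewrite size_flatten /shape -map_comp sumnE big_map enumT; apply: eq_bigr => i _ /=;
      rewrite size_map.
  have [|z p q zF pN qN bp bq|j _ jP] :=
    @exists_avoiding _ F (fun z j => ideal_exp [set` P] k (z - j%:R)) N.+1.
  + by rewrite sF.
  + wlog pq : p q pN qN bp bq / (p < q)%N.
      by move=> H; case: (ltngtP p q) => [|/(H q p)->|] //; apply: H.
    case/negP: mP; have pq' : (q - p %| m)%N by apply: dvdn_fact; rewrite subn_gt0 pq; lia.
    rewrite -(divnK pq') natrM; apply: idealMr.
    have := ideal_exp_sub k0 (ideal_expB bp bq).
    by rewrite natrB ?(ltnW pq) // (_ : z - p%:R - _ = q%:R - p%:R) //; ring.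
  + exists j%:R => z Pz; apply/negP => /jP; exact.
- move=> i j ij; apply/negP => ijD; apply: (ZP ((i, j), y i - y j)) => /=.
    by apply/allpairsP; exists ((i, j), y i - y j) => /=; rewrite mem_enum.
  by split=> //; rewrite /y; ring.
Qed.

End Placement.

(** * Local dependence *)

Section PointwiseTopology.
Variables (K : fieldExtType rat) (k : nat).
Local Notation OK := (int_ring K).
Local Notation X := (set_type (@free_subsets K k)).

Lemma subsets_cvg (F : set_system (subsets K)) (S : subsets K) : Filter F ->
  (forall x, F [set T | T x = S x]) -> F --> S.
Proof.
move=> FF FS; apply/cvg_sup => x; apply/cvg_image.
  by rewrite eqEsubset; split=> // b _; exists (fun=> b).
move=> U nU /=; exists ((fun T : subsets K => T x) @^-1` U).
  by apply: filterS (FS x) => T /= ->; apply: nbhs_singleton.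
by rewrite image_preimage //; rewrite eqEsubset; split=> // b _; exists (fun=> b).
Qed.

Lemma free_subsets_cvg (F : set_system X) (S : X) : Filter F ->
  (forall x, F [set T | val T x = val S x]) -> F --> S.
Proof.
move=> FF FS A; rewrite nbhsE => -[B [[V oV <-] VS] BA].
apply: (filterS BA).
apply: (@subsets_cvg (val @ F) (val S) _ FS V).
exact: open_nbhs_nbhs.
Qed.

Lemma free_eval_continuous x : continuous (fun S : X => val S x).
Proof.
move=> S.
apply: (@continuous_comp X (subsets K) bool set_val (fun S => S x)).
  exact: initial_continuous.
exact: Defs.eval_continuous.
Qed.

(** The convergence of this filter to [S] is what turns continuity into dependence on finitely many
    coordinates, as in [continuous_local]. *)
Definition cylinder_filter (S : X) : set_system X :=
  [set U | exists W : seq OK, forall S' : X, {in W, val S' =1 val S} -> U S'].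

Lemma cylinder_filterP S : Filter (cylinder_filter S).
Proof.
split.
- by exists [::].
- move=> U V [W1 U1] [W2 V2]; exists (W1 ++ W2) => S' S'W; split.
    by apply: U1 => w wW; apply: S'W; rewrite mem_cat wW.
  by apply: V2 => w wW; apply: S'W; rewrite mem_cat wW orbT.
- by move=> U V UV [W UW]; exists W => S' /UW/UV.
Qed.

Lemma cylinder_filter_cvg S : cylinder_filter S --> S.
Proof.
have FF := cylinder_filterP S; apply: free_subsets_cvg => x.
by exists [:: x] => S' /(_ x (mem_head _ _)).
Qed.

End PointwiseTopology.

Lemma continuous_local (K L : fieldExtType rat) (k l : nat)
    (f : set_type (@free_subsets K k) -> set_type (@free_subsets L l))
    (S : set_type (@free_subsets K k)) b :
  continuous f -> exists W : seq (int_ring K),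
    forall S', {in W, val S' =1 val S} -> val (f S') b = val (f S) b.
Proof.
move=> cf; have FF := cylinder_filterP S.
have : (fun T => val (f T) b) @ S --> val (f S) b.
  apply: (@continuous_comp _ _ _ f (fun T => val T b)); first exact: cf.
  exact: free_eval_continuous.
have nb : nbhs (val (f S) b) [set val (f S) b] by apply: open_nbhs_nbhs; split=> //;
  apply: discrete_open.
by move=> /(_ _ nb) /(@cylinder_filter_cvg _ _ S).
Qed.

Lemma coordinatewise_continuous (K L : fieldExtType rat) (k l : nat)
    (f : set_type (@free_subsets K k) -> set_type (@free_subsets L l))
    (h : int_ring L -> int_ring K) :
  (forall S b, val (f S) b = val S (h b)) -> continuous f.
Proof.
move=> fh S; have FF : Filter (f @ S) := fmap_filter f (nbhs_filter S).
apply: free_subsets_cvg => x.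
have nb : nbhs (val S (h x)) [set val S (h x)].
  by apply: open_nbhs_nbhs; split=> //; apply: discrete_open.
have H := @free_eval_continuous K k (h x) S _ nb.
by apply: (@filterS _ (nbhs S) (nbhs_filter S) _ _ _ H) => T /= ET; rewrite !fh.
Qed.

(** * Strictness of powers of prime ideals *)

Section Strict.
Variables (K : fieldExtType rat) (P : prime_idealr (int_ring K)).
Local Notation OK := (int_ring K).

Lemma det_one_sub N (Q : 'M[OK]_N) : (forall i j, Q i j \in P) -> \det (1%:M - Q) - 1 \in P.
Proof.
move=> QP; pose phi : {rmorphism OK -> {ideal_quot P}} := \pi_({ideal_quot P})%qT.
suff : phi (\det (1%:M - Q) - 1) = 0.
  by move/eqP; rewrite -(rmorph0 phi) -Quotient.idealrBE subr0.
rewrite rmorphB -det_map_mx map_mxB map_mx1.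
suff -> : map_mx phi Q = 0 by rewrite subr0 det1 rmorph1 subrr.
apply/matrixP => i j; rewrite !mxE; apply/eqP.
by rewrite -(rmorph0 phi) -Quotient.idealrBE subr0.
Qed.

(* Nakayama: if the powers stabilised at [P ^ n], finitely many generators [g] of [P ^ n]
   would satisfy [(1 - Q) g = 0] for a matrix [Q] over [P], so [det (1 - Q) = 0], whereas
   [det (1 - Q)] is [1] modulo [P]. *)
Lemma ideal_exp_strict n : nonzero_ideal P ->
  exists2 x, ideal_exp [set` P] n x & ~ ideal_exp [set` P] n.+1 x.
Proof.
move=> P0; apply: contrapT => none.
have sub x : ideal_exp [set` P] n x -> ideal_exp [set` P] n.+1 x.
  by move=> xP; apply: contrapT => nx; apply: none; exists x.
have [m m0 mP] := prime_pow_nat n P0.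
have [s sP] := finite_residues K m0.
have gen a : exists g, ideal_exp [set` P] n g /\
    forall x, ideal_exp [set` P] n x -> (exists z, x - a = m%:R * z) -> exists z,
      x - g = m%:R * z.
  have [[x [xP [z Ez]]]|no] := pselect (exists x, ideal_exp [set` P] n x /\
    exists z, x - a = m%:R * z).
    exists x; split=> // y _ [z' Ez']; exists (z' - z).
    by rewrite mulrBr -Ez -Ez'; ring.
  exists 0; split; first by case: (ideal_exp_ideal [set` P] n).
  by move=> x xP xa; case: no; exists x.
have [gf gfP] := choice gen.
(* [m], together with an element of [P ^ n] from each class modulo [m] that meets [P ^ n], generates
   [P ^ n]; a class that does not meet it contributes 0. *)
pose G := m%:R :: map gf s; pose N := size G.
have GP i : ideal_exp [set` P] n (tnth (in_tuple G) i).
  have : tnth (in_tuple G) i \in G by apply: mem_tnth.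
  rewrite inE => /predU1P[->|/mapP[a _ ->]]; last by case: (gfP a).
  by rewrite -[m%:R]mulr1.
have span x : ideal_exp [set` P] n x -> exists c :
  'I_N -> OK, x = \sum_i c i * tnth (in_tuple G) i.
  move=> xP; have [a sa xa] := sP x.
  have [_ /(_ x xP xa)[z Ez]] := gfP a.
  have i1 : gf a \in in_tuple G by rewrite inE map_f ?orbT.
  have i0 : m%:R \in in_tuple G by rewrite inE eqxx.
  have [i Ei] := tnthP _ _ i1; have [j Ej] := tnthP _ _ i0.
  exists (fun h => (h == i)%:R + (h == j)%:R * z).
  under eq_bigr do rewrite mulrDl.
  rewrite big_split /= (bigD1 i) //= eqxx mul1r big1 ?addr0; last first.
    by move=> h /negPf ->; rewrite mul0r.
  rewrite (bigD1 j) //= eqxx mul1r [X in _ + (_ + X)]big1 ?addr0; last first.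
    by move=> h /negPf ->; rewrite !mul0r.
  by rewrite -Ei -Ej [z * _]mulrC -Ez; ring.
have spanP x : ideal_exp [set` P] n.+1 x ->
    exists c : 'I_N -> OK, (forall i, c i \in P) /\ x = \sum_i c i * tnth (in_tuple G) i.
  move=> [u [uP ->]]; rewrite big_seq;
    elim/big_ind: _ => [|x1 x2 [c1 [c1P ->]] [c2 [c2P ->]]|p pu].
  - exists (fun=> 0); split=> [i|]; first exact: rpred0.
    by rewrite big1 // => i _; rewrite mul0r.
  - exists (fun i => c1 i + c2 i); split=> [i|]; first exact: rpredD.
    by rewrite -big_split; apply: eq_bigr => i _; rewrite mulrDl.
  - have [p1 p2] := uP p pu; have [c ->] := span _ p2.
    exists (fun i => p.1 * c i); split=> [i|]; first by rewrite mulrC; apply: idealMr.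
    by rewrite mulr_sumr; apply: eq_bigr => i _; rewrite mulrA.
have [c cP] := choice (fun i => spanP _ (sub _ (GP i))).
pose Q := \matrix_(i, j) c i j; pose g := \col_i tnth (in_tuple G) i.
have Qg : (1%:M - Q) *m g = 0.
  apply/matrixP => i j; rewrite mulmxBl mul1mx !mxE; apply/eqP.
  rewrite subr_eq0 {1}(cP i).2; apply/eqP/eq_bigr => h _.
  by rewrite !mxE.
have : \adj (1%:M - Q) *m ((1%:M - Q) *m g) = 0 by rewrite Qg mulmx0.
rewrite mulmxA mul_adj_mx mul_scalar_mx => /matrixP /(_ ord0 ord0).
rewrite !mxE => /eqP; rewrite int_ring_mulf_eq0 /= (tnth_nth 0) /=.
rewrite int_ring_natr_eq0 eqn0Ngt m0 orbF => /eqP d0.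
have QP i j : Q i j \in P by rewrite mxE; exact: (cP i).1.
by have := det_one_sub QP; rewrite d0 sub0r rpredN prime_ideal1.
Qed.

(** As [w] generates the quotient by [P ^ k], every element of [P] is a multiple of [r] modulo
    [P ^ k], and every element of [P ^ i] a multiple of [r ^ i]. If [l < k], then [P ^ l] would lie
    in [P ^ k], against [ideal_exp_strict]. *)
Lemma ideal_exp_cyclic_leq k l r w : nonzero_ideal P -> prime r -> r%:R \in P ->
  (forall x, exists n : nat, ideal_exp [set` P] k (x - n%:R * w)) ->
  ideal_exp [set` P] k (r%:R ^+ l) -> (k <= l)%N.
Proof.
move=> P0 pr rP cyc rlP; rewrite leqNgt; apply/negP => lk.
have k0 : (0 < k)%N by apply: leq_ltn_trans lk.
have wP : w \notin P.
  apply/negP => wP; have [n nP] := cyc 1.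
  suff : 1 \in P by rewrite prime_ideal1.
  rewrite -[1](subrK (n%:R * w)); apply: rpredD; first exact: ideal_exp_sub k0 nP.
  exact: idealMr.
have sub1 x : x \in P -> exists z, ideal_exp [set` P] k (x - r%:R * z).
  move=> xP; have [n nP] := cyc x.
  have : n%:R * w \in P.
    by rewrite -[_ * _](subKr x); apply: rpredB => //; apply: ideal_exp_sub k0 nP.
  rewrite prime_idealrM (negPf wP) orbF (prime_ideal_dvdn _ pr rP) => /dvdnP[d Ed].
  by exists (d%:R * w); rewrite mulrA -natrM mulnC -Ed.
have subi i x : ideal_exp [set` P] i x -> exists z, ideal_exp [set` P] k (x - r%:R ^+ i * z).
  elim: i x => [|i IH] x.
    by move=> _; exists x; rewrite expr0 mul1r subrr; case: (ideal_exp_ideal [set` P] k).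
  move=> [s [sP ->]]; rewrite big_seq;
    elim/big_ind: _ => [|x1 x2 [z1 H1] [z2 H2]|p /sP[p1 /IH[z2 H2]]].
  - by exists 0; rewrite mulr0 subrr; case: (ideal_exp_ideal [set` P] k).
  - exists (z1 + z2); have := ideal_expD H1 H2; congr (ideal_exp _ _ _); ring.
  - have [z1 H1] := sub1 _ p1; exists (z1 * z2).
    have := ideal_expD (ideal_expM p.1 H2) (ideal_expM (r%:R ^+ i * z2) H1).
    by congr (ideal_exp _ _ _); rewrite exprS; ring.
have [x xl] := ideal_exp_strict l P0; apply; have [z xz] := subi _ _ xl.
apply: (ideal_exp_anti lk); rewrite -[x](subrK (r%:R ^+ l * z)).
by apply: ideal_expD => //; rewrite mulrC; apply: ideal_expM.
Qed.

End Strict.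

(** * Unramified primes of degree one *)

Lemma prime_coprimez r (z : int) : prime r -> ~~ (r %| z)%Z ->
  exists u v : int, u * z + v * r%:Z = 1.
Proof.
move=> pr; rewrite dvdzE absz_nat -prime_coprime // => co.
have /coprimezP[[u v] /= E] : coprimez z r by rewrite /coprimez /gcdz coprime_sym in co *.
by exists u, v.
Qed.

Lemma prime_Euclid_dvdzM r (y z : int) : prime r -> (r %| y * z)%Z = (r %| y)%Z || (r %| z)%Z.
Proof. by move=> pr; rewrite !dvdzE abszM absz_nat Euclid_dvdM. Qed.

Lemma prime_Euclid_dvdzX r (y : int) n : prime r -> (r %| y ^+ n)%Z -> (r %| y)%Z.
Proof.
move=> pr; elim: n => [|n IH]; first by rewrite expr0 dvdz1 absz_nat => /eqP r1; rewrite r1 in pr.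
by rewrite exprS prime_Euclid_dvdzM // => /orP[].
Qed.

(* Schur's argument: [g (g 0 * N! * y) / g 0] is [1] modulo [N!], and a unit for few [y] only. *)
Lemma poly_prime_divisors (g : {poly int}) N : (1 < size g)%N ->
  exists r, [/\ (N < r)%N, prime r & exists a, (r %| g.[a])%Z].
Proof.
move=> sg; set c := g.[0].
have [q Nq pq] := prime_above N.
have [c0|c0] := eqVneq c 0.
  by exists q; split=> //; exists 0; rewrite -/c c0 dvdz0.
have szc (z : int) : g + z%:P != 0.
  apply: contraTneq sg => /eqP; rewrite addr_eq0 => /eqP ->.
  by rewrite size_polyN size_polyC -leqNgt; case: eqP.
have [k Ek] : exists k, g = c%:P + 'X * k.
  have /factor_theorem[k Ek] : root (g - c%:P) 0 by rewrite /root !hornerE subrr.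
  by exists k; rewrite mulrC -[g](subrK c%:P) Ek subr0 addrC.
pose F := (g - c%:P) * (g + c%:P).
have F0 : F != 0 by rewrite mulf_neq0 // -polyCN.
pose a (y : nat) : int := c * N`!%:Z * y%:Z.
have [y Fy] : exists y, ~~ root F (a y).
  apply: contrapT => none.
  have := @max_poly_roots _ F [seq a y | y <- iota 0 (size F)] F0.
  rewrite size_map size_iota ltnn map_inj_uniq ?iota_uniq.
    move=> H; suff : false by []; apply: H => //; apply/allP => _ /mapP[y _ ->].
    by apply/negPn/negP => ny; apply: none; exists y.
  move=> y y' /mulfI E; apply/eqP; rewrite -eqz_nat; apply/eqP/E.
  by rewrite mulf_neq0 // eqz_nat -lt0n fact_gt0.
pose v := 1 + N`!%:Z * y%:Z * k.[a y].
have Ev : g.[a y] = c * v.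
  by rewrite {1}Ek !hornerE /v /a; ring.
have [v0|v0] := eqVneq v 0.
  by exists q; split=> //; exists (a y); rewrite Ev v0 mulr0 dvdz0.
have v1 : (1 < `|v|)%N.
  rewrite ltn_neqAle eq_sym absz_gt0 v0 andbT; apply: contra Fy => /eqP v1.
  rewrite /root hornerM !hornerE Ev.
  have [->|->] : v = 1 \/ v = -1 by lia.
    by rewrite mulr1 subrr mul0r.
  by rewrite mulrN1 addNr mulr0.
exists (pdiv `|v|); split; [|exact: pdiv_prime|]; last first.
  by exists (a y); rewrite Ev dvdz_mull // dvdzE absz_nat pdiv_dvd.
rewrite ltnNge; apply/negP => le.
have pr := pdiv_prime v1; set r := pdiv `|v| in le pr *.
have rv : (r %| v)%Z by rewrite dvdzE absz_nat pdiv_dvd.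
have rN : (r %| N`!%:Z * y%:Z * k.[a y])%Z.
  by rewrite -mulrA dvdz_mulr // dvdzE !absz_nat dvdn_fact // prime_gt0.
have : (r %| v - N`!%:Z * y%:Z * k.[a y])%Z by apply: rpredB.
by rewrite addrK dvdz1 absz_nat => /eqP r1; rewrite r1 in pr.
Qed.

Lemma dvdp_prime_lift r (g h : {poly int}) : prime r ->
  (map_poly intr g : {poly 'F_r}) %| map_poly intr h ->
  exists s t : {poly int}, h = g * s + r%:Z *: t.
Proof.
move=> pr /dvdpP[s' Es].
pose s := map_poly (fun u : 'F_r => (nat_of_ord u)%:Z) s'.
have Es' : map_poly intr s = s' :> {poly 'F_r}.
  apply/polyP => i; rewrite coef_map coef_map_id0 //=.
  by apply: val_inj; rewrite /= -pmulrn natr_Zp.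
exists s, (map_poly (fun z => (z %/ r)%Z) (h - g * s)).
suff E : h - g * s = r%:Z *: map_poly (fun z => (z %/ r)%Z) (h - g * s).
  by rewrite -E addrC subrK.
apply/polyP => i; rewrite coefZ coef_map_id0 ?div0z // [RHS]mulrC divzK //.
rewrite (dvdz_pcharf (pchar_Fp pr)) -coef_map rmorphB rmorphM /= Es' Es mulrC subrr.
by rewrite coef0.
Qed.

Section SplitPrimes.
Variable L : fieldExtType rat.
Local Notation OL := (int_ring L).

Lemma primitive_element : exists z : L, <<1%AS; z>>%VS = fullv.
Proof.
have pch : [pchar L] =i pred0.
  by apply/pcharf0P => n; rewrite natr_fieldExt_eq0.
have adj (s : seq L) : exists z, <<1%AS & s>>%VS = <<1%AS; z>>%VS.
  elim/last_ind: s => [|s x [z Ez]].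
    by exists 0; rewrite Fadjoin_nil Fadjoin0.
  have [z' Ez'] := @Primitive_Element_Theorem _ L 1%AS x z (pcharf0_separable 1%AS pch z).
  by exists z'; rewrite adjoin_rcons Ez.
have [z Ez] := adj (vbasis {:L}); exists z; rewrite -Ez; apply/eqP.
rewrite eqEsubv subvf /= -{1}(span_basis (vbasisP {:L})).
by apply/span_subvP => x; apply: seqv_sub_adjoin.
Qed.

Definition int_eval (x : OL) (p : {poly int}) : OL := (map_poly intr p).[x].

Lemma int_evalD x p q : int_eval x (p + q) = int_eval x p + int_eval x q.
Proof. by rewrite /int_eval rmorphD hornerD. Qed.

Lemma int_evalB x p q : int_eval x (p - q) = int_eval x p - int_eval x q.
Proof. by rewrite /int_eval rmorphB hornerD hornerN. Qed.

Lemma int_evalM x p q : int_eval x (p * q) = int_eval x p * int_eval x q.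
Proof. by rewrite /int_eval rmorphM hornerM. Qed.

Lemma int_evalZ x c p : int_eval x (c *: p) = c%:~R * int_eval x p.
Proof. by rewrite /int_eval map_polyZ hornerZ. Qed.

Lemma int_evalC x c : int_eval x c%:P = c%:~R.
Proof. by rewrite /int_eval map_polyC hornerC. Qed.

Lemma int_evalX x : int_eval x 'X = x.
Proof. by rewrite /int_eval map_polyX hornerX. Qed.

Definition int_evalE := (int_evalB, int_evalD, int_evalM, int_evalZ, int_evalC, int_evalX).

Lemma int_eval_val x p : val (int_eval x p) = (map_poly intr p).[val x].
Proof.
rewrite /int_eval -horner_map -map_poly_comp.
by rewrite (eq_map_poly (g := intr)) // => z; apply: int_ring_val_intr.
Qed.

Lemma integral_generator : exists x : OL, forall y, exists2 d : int, d != 0 &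
  exists p, d%:~R * y = int_eval x p.
Proof.
have [z Ez] := primitive_element; have [d d0 [x Ex]] := int_ring_multiple z.
exists x => y.
have : val y \in <<1%AS; val x>>%VS.
  have : (<<1; z>> <= <<1; val x>>)%VS.
    rewrite sub_adjoin1v; have -> : z = (d%:R : rat)^-1 *: val x.
      by rewrite Ex mulr_natl -scaler_nat scalerA mulVf ?scale1r // Num.Theory.pnatr_eq0 -lt0n.
    by apply: memvZ; apply: memv_adjoin.
  by move/subvP; apply; rewrite Ez memvf.
case/Fadjoin1_polyP => p Ep; have [q [a a0 Eq]] := rat_poly_scale p.
exists a => //; exists q; apply: val_inj; rewrite int_eval_val rmorphM /= int_ring_val_intr.
have algZ (c : int) : in_alg L c%:~R = c%:~R by apply: (rmorph_int (in_alg L)).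
rewrite Ep Eq map_polyZ hornerZ -map_poly_comp mulrA -algZ -rmorphM mulfV ?intr_eq0 //.
rewrite rmorph1 mul1r.
by congr _.[_]; apply: eq_map_poly => u; apply: (rmorph_int (in_alg L)).
Qed.

(** [g] has least degree among the nonzero integer polynomials vanishing at [x]. Pseudo-division
    gives the third clause. The fourth clears denominators in a rational Bezout identity, and its
    [d] acts as a discriminant: [g] stays separable modulo primes not dividing [d]. *)
Lemma minimal_int_poly (x : OL) : exists g : {poly int},
  [/\ int_eval x g = 0, (1 < size g)%N,
    forall p, int_eval x p = 0 -> exists e q, lead_coef g ^+ e *: p = q * g &
    exists (d : int) u v, d != 0 /\ u * g + v * g^`() = d%:P].
Proof.
pose Ps n := `[< exists p : {poly int}, [/\ p != 0, int_eval x p = 0 & size p = n] >].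
have exP : exists n, Ps n.
  have [p p0 px] := int_poly_root (val x); exists (size p); apply/asboolP; exists p; split=> //.
  by apply: val_inj; rewrite int_eval_val (eqP px) rmorph0.
case: (ex_minnP exP) => n /asboolP[g [g0 gx sg]] nmin.
have gmin p : int_eval x p = 0 -> (size p < size g)%N -> p = 0.
  move=> px; rewrite ltnNge => /negP lt; apply/eqP/negPn/negP => p0; apply: lt.
  by rewrite sg; apply: nmin; apply/asboolP; exists p.
have sg1 : (1 < size g)%N.
  rewrite ltnNge; apply/negP => /size1_polyC Eg; move: gx g0.
  rewrite Eg int_evalC polyC_eq0 => /(congr1 val) /eqP.
  by rewrite int_ring_val_intr rmorph0 intr_fieldExt_eq0 => /eqP ->; rewrite eqxx.
exists g; split=> //.
  move=> p px; exists (Pdiv.Idomain.scalp p g), (p %/ g).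
  rewrite Pdiv.Idomain.divp_eq; suff -> : p %% g = 0 by rewrite addr0.
  apply: gmin; last by rewrite Pdiv.Idomain.ltn_modp.
  have : int_eval x (lead_coef g ^+ scalp p g *: p) = 0 by rewrite int_evalZ px mulr0.
  by rewrite Pdiv.Idomain.divp_eq int_evalD int_evalM gx mulr0 add0r.
pose Q (p : {poly int}) : {poly rat} := map_poly intr p.
have QI : injective Q by apply: map_inj_poly; [exact: intr_inj|].
pose evQ (p : {poly rat}) : L := (map_poly (in_alg L) p).[val x].
have evQ_Q p : evQ (Q p) = val (int_eval x p).
  rewrite /evQ /Q int_eval_val -map_poly_comp; congr _.[_]; apply: eq_map_poly => z.
  exact: (rmorph_int (in_alg L)).
have evQM p q : evQ (p * q) = evQ p * evQ q by rewrite /evQ rmorphM hornerM.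
have qmin (p : {poly rat}) : evQ p = 0 -> (size p < size g)%N -> p = 0.
  have [p' [c c0 Ep]] := rat_poly_scale p.
  have := evQ_Q p'; rewrite /evQ /Q Ep map_polyZ hornerZ => -> /eqP.
  rewrite mulf_eq0 fmorph_eq0 invr_eq0 intr_eq0 (negPf c0) /= => /eqP.
  rewrite size_scale ?invr_eq0 ?intr_eq0 // size_rat_int_poly.
  move=> E sp; have -> : p' = 0.
    by apply: gmin sp; apply: val_inj; rewrite rmorph0; exact: E.
  by rewrite rmorph0 scaler0.
(* Write [g = E * D] over the rationals with [D] the gcd. If [E] vanishes at [x], minimality makes
   [D] constant; if [D] does, it is as large as [g] and divides the derivative, which would be 0. *)
have co : coprimep (Q g) (Q g)^`().
  rewrite /coprimep; set D := gcdp _ _.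
  have Qg0 : Q g != 0 by rewrite -size_poly_eq0 size_rat_int_poly size_poly_eq0.
  have D0 : D != 0 by rewrite gcdp_eq0 negb_and Qg0.
  have /dvdpP[E EE] : D %| Q g by apply: dvdp_gcdl.
  have E0 : E != 0 by apply: contraNneq Qg0 => E0; rewrite EE E0 mul0r.
  have sE : size (Q g) = (size E + size D).-1 by rewrite EE size_mul.
  rewrite size_rat_int_poly in sE.
  have sD0 : (0 < size D)%N by rewrite lt0n size_poly_eq0.
  have sE0 : (0 < size E)%N by rewrite lt0n size_poly_eq0.
  have /eqP : evQ E * evQ D = 0 by rewrite -evQM -EE evQ_Q gx rmorph0.
  rewrite mulf_eq0 => /orP[/eqP/qmin E1|/eqP/qmin D1]; last first.
    have [lt|le] := ltnP (size D) (size g); first by rewrite (D1 lt) eqxx in D0.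
    have dD : D %| (Q g)^`() by apply: dvdp_gcdr.
    have d0 : (Q g)^`() = 0.
      apply/eqP/negPn/negP => d0; have := dvdp_leq d0 dD.
      by rewrite leqNgt (leq_trans (lt_size_deriv Qg0)) // size_rat_int_poly.
    have /eqP := congr1 (fun p : {poly rat} => p`_(size g).-2) d0.
    rewrite coef_deriv coef0 mulrn_eq0 /= (_ : (size g).-2.+1 = (size g).-1); last by lia.
    by rewrite coef_map intr_eq0 -lead_coefE lead_coef_eq0 (negPf g0).
  apply/eqP; apply: contrapT => sD1; case/eqP: E0; apply: E1; rewrite sE.
  by case: (size D) sD0 sD1 => [|[|m]] // _ _; rewrite !addnS /= ltnS leq_addr.
have [[u v] /= E] := Bezout_eq1_coprimepP _ _ co.
have [u' [a a0 Eu]] := rat_poly_scale u; have [v' [b b0 Ev]] := rat_poly_scale v.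
exists (a * b), (b *: u'), (a *: v'); split; first by rewrite mulf_neq0.
apply: QI; rewrite /Q rmorphD !rmorphM /= !map_polyZ -deriv_map !map_polyC /=.
have -> : (a%:~R)%:P * (b%:~R)%:P = (a%:~R * b%:~R : rat) *: (u * Q g + v * (Q g)^`()).
  by rewrite E alg_polyC polyCM.
rewrite Eu Ev -!scalerAl scalerDr !scalerA; congr (_ *: _ + _ *: _).
  by rewrite mulrAC mulfV ?intr_eq0 // mul1r.
by rewrite mulfK ?intr_eq0.
Qed.

(** * Dedekind's criterion and the prime ideal [(r, x - a)] *)

Section SplitPrime.
Variables (x : OL) (g u v : {poly int}) (d : int) (r : nat).
Hypothesis x_gen : forall y, exists2 d : int, d != 0 & exists p, d%:~R * y = int_eval x p.
Hypothesis gx : int_eval x g = 0.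
Hypothesis g_min : forall p, int_eval x p = 0 -> exists e q, lead_coef g ^+ e *: p = q * g.
Hypothesis g_sep : u * g + v * g^`() = d%:P.
Hypotheses (pr : prime r) (rc : ~~ (r %| lead_coef g)%Z) (rd : ~~ (r %| d)%Z).

(* Dedekind's criterion: if [r y = p(x)] with [y] integral, then [p] is nilpotent, hence zero,
   modulo [r] and the separable polynomial [g]. *)
Lemma int_eval_divr y p : r%:R * y = int_eval x p -> exists q, y = int_eval x q.
Proof.
move=> Ey; have /algebraic_integerP [h mh /eqP hy] := valP y.
have sh : (0 < size h)%N by rewrite lt0n size_poly_eq0 monic_neq0.
pose n := (size h).-1.
have snh : size h = n.+1 by rewrite prednK.
have hn : h`_n = 1 by move/eqP: mh; rewrite lead_coefE.
have sum0 : \sum_(i < n.+1) (h`_i)%:~R * y ^+ i = 0.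
  apply: val_inj; rewrite rmorph_sum rmorph0 -[RHS]hy.
  have -> : (map_poly intr h : {poly L}) = \poly_(i < n.+1) (h`_i)%:~R.
    apply/polyP => i; rewrite coef_map !coef_poly; case: ltnP => // ni.
    by rewrite nth_default // snh.
  by rewrite horner_poly; apply: eq_bigr => i _; rewrite rmorphM rmorphXn /= int_ring_val_intr.
(* Multiplying [h(y) = 0] by [r ^ n] and replacing [r * y] by [p] gives [W]: it vanishes at [x] and
   reduces to [p ^ n] modulo [r]. *)
pose W := p ^+ n + r%:Z *: \sum_(i < n) (h`_i * r%:Z ^+ (n.-1 - i)) *: p ^+ i.
have evX q m : int_eval x (q ^+ m) = int_eval x q ^+ m.
  by rewrite /int_eval rmorphXn horner_exp.
have W0 : int_eval x W = 0.
  rewrite /W int_evalD int_evalZ evX -Ey.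
  have -> : int_eval x (\sum_(i < n) (h`_i * r%:Z ^+ (n.-1 - i)) *: p ^+ i) =
      \sum_(i < n) (h`_i * r%:Z ^+ (n.-1 - i))%:~R * (r%:R * y) ^+ i.
    rewrite /int_eval rmorph_sum horner_sum; apply: eq_bigr => i _.
    by rewrite -/(int_eval x _) int_evalZ evX -Ey.
  transitivity (r%:R ^+ n * (\sum_(i < n) (h`_i)%:~R * y ^+ i + y ^+ n)); last first.
    by move: sum0; rewrite big_ord_recr /= hn mul1r => ->; rewrite mulr0.
  rewrite [LHS]addrC mulrDr -exprMn; congr (_ + _).
  rewrite !mulr_sumr; apply: eq_bigr => i _.
  have in1 : n = ((n.-1 - i) + i).+1 by have := ltn_ord i; lia.
  by rewrite [X in _ = _ ^+ X * _]in1 exprS exprD exprMn rmorphM rmorphXn /=; ring.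
have [e [q Eq]] := g_min W0.
pose M (p : {poly int}) : {poly 'F_r} := map_poly intr p.
have chr := dvdz_pcharf (pchar_Fp pr).
have M_r p' : M (r%:Z *: p') = 0.
  rewrite /M map_polyZ /=; have -> : (r%:Z)%:~R = 0 :> 'F_r by apply/eqP; rewrite -chr dvdzz.
  by rewrite scale0r.
have MW : M W = M p ^+ n by rewrite /M rmorphD rmorphXn /= -[map_poly _ (_ *: _)]/(M _) M_r addr0.
have gpn : M g %| M p ^+ n.
  rewrite -MW -(@dvdpZr _ ((lead_coef g)%:~R ^+ e)); last by rewrite expf_neq0 // -chr.
  by rewrite -rmorphXn /M -map_polyZ Eq rmorphM dvdp_mull.
have sepg : separable_poly (M g).
  rewrite unlock; apply/Bezout_eq1_coprimepP.
  exists ((d%:~R^-1)%:P * M u, (d%:~R^-1)%:P * M v) => /=.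
  have E : M u * M g + M v * (M g)^`() = (d%:~R)%:P.
    by rewrite /M deriv_map -!rmorphM -rmorphD g_sep /= map_polyC.
  by rewrite -!mulrA -mulrDr E -polyCM mulVf // -chr.
have gp : M g %| M p.
  have /dvdpP[a Ea] := dvdp_gcdl (M g) (M p).
  move: sepg; rewrite Ea separable_mul => /and3P[_ _ co].
  have cop : coprimep a (M p).
    apply/coprimepP => b ba bp; apply: (coprimepP _ _ co) => //.
    by rewrite dvdp_gcd bp Ea dvdp_mulr.
  have ag : a %| M p ^+ n by apply: dvdp_trans gpn; rewrite Ea dvdp_mulr.
  have a1 : a %= 1 by rewrite -size_poly_eq1 -coprimepp; apply: coprimep_dvdl ag _;
    apply: coprimep_expr.
  by rewrite Ea (eqp_dvdl _ (eqp_mulr _ a1)) mul1r dvdp_gcdr.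
have [s [t Et]] := dvdp_prime_lift pr gp.
exists t; apply: (int_ring_mulnI (prime_gt0 pr)).
by rewrite Ey Et int_evalD int_evalM gx mul0r add0r int_evalZ.
Qed.

(** Factors [r] of a denominator are removed one at a time by [int_eval_divr]. *)
Lemma int_eval_coprime_multiple y : exists d' : int, ~~ (r %| d')%Z /\
  exists p, d'%:~R * y = int_eval x p.
Proof.
have [d0] := x_gen y; elim/ltn_ind: {d0}`|d0|%N {-2}d0 (erefl `|d0|%N) => n IH d0 En d00 [p Ep].
have [rd0|] := boolP (r %| d0)%Z; last by move=> nr; exists d0; split=> //; exists p.
have E := divzK rd0; have [|q Eq] := @int_eval_divr ((d0 %/ r)%Z%:~R * y) p.
  by rewrite -Ep -[in RHS]E rmorphM /=; ring.
have d1 : (d0 %/ r)%Z != 0 by apply: contraNneq d00 => d1; rewrite -E d1 mul0r.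
apply: (IH _ _ (d0 %/ r)%Z erefl d1); last by exists q.
rewrite -En -[in X in (_ < X)%N]E abszM absz_nat ltn_Pmulr ?absz_gt0 //.
exact: prime_gt1.
Qed.

Variables (a m : int).
Hypothesis ga : g.[a] = r%:Z * m.

(* [Q] is the ideal [(r, x - a)], of residue field [F_r] and unramified over [r]. *)
Let t : OL := x - a%:~R.
Let Q : set OL := [set y | exists y1 y2, y = r%:R * y1 + t * y2].

Lemma poly_taylor1 (p : {poly int}) : exists q, p = p.[a]%:P + ('X - a%:P) * q.
Proof.
have /factor_theorem[q Eq] : root (p - p.[a]%:P) a by rewrite /root !hornerE subrr.
by exists q; rewrite mulrC -Eq addrC subrK.
Qed.

Lemma root_shift_eval : t = int_eval x ('X - a%:P).
Proof. by rewrite !int_evalE. Qed.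

Lemma split_ideal_residue y : exists n : int, Q (y - n%:~R).
Proof.
have [d' [rd' [p Ep]]] := int_eval_coprime_multiple y.
have [al [be E]] := prime_coprimez pr rd'.
have [q Eq] := poly_taylor1 p.
exists (al * p.[a]), (be%:~R * y), (al%:~R * int_eval x q).
have := congr1 (int_eval x) Eq; rewrite int_evalD int_evalC int_evalM -Ep -root_shift_eval => E1.
have Ey : y = al%:~R * (d'%:~R * y) + be%:~R * r%:R * y.
  by rewrite mulrA -mulrDl -[r%:R]/((r%:Z)%:~R) -!rmorphM -rmorphD E mul1r.
by rewrite {1}Ey E1 rmorphM /=; ring.
Qed.

Lemma split_ideal_is_ideal : is_ideal Q.
Proof.
split; first by exists 0, 0; ring.
  by move=> _ _ [y1 [y2 ->]] [z1 [z2 ->]]; exists (y1 + z1), (y2 + z2); ring.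
by move=> z _ [y1 [y2 ->]]; exists (z * y1), (z * y2); ring.
Qed.

(** Clearing denominators in [1 = r * y + t * z] gives a polynomial vanishing at [x], so a multiple
    of [g] up to a power of its leading coefficient. Evaluated at [a], where [r] divides [g], it
    makes [r] divide a product of integers prime to [r]. *)
Lemma split_ideal_proper : ~ Q 1.
Proof.
move=> [y [z E]].
have [d1 [rd1 [p1 E1]]] := int_eval_coprime_multiple y.
have [d2 [rd2 [p2 E2]]] := int_eval_coprime_multiple z.
pose W := (d1 * d2)%:P - (r%:Z * d2) *: p1 - ('X - a%:P) * (d1 *: p2).
have W0 : int_eval x W = 0.
  rewrite /W !int_evalB int_evalC int_evalM !int_evalZ -root_shift_eval -E1 -E2 !rmorphM /=.
  rewrite -[r%:Z%:~R]/(r%:R); transitivity (d1%:~R * d2%:~R * (1 - (r%:R * y + t * z)) : OL).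
    by ring.
  by rewrite -E subrr mulr0.
have [e [q /(congr1 (fun p => p.[a]))]] := g_min W0.
have WE : W.[a] = d1 * d2 - r%:Z * d2 * p1.[a] by rewrite /W !(hornerD, hornerN, hornerM,
  hornerZ, hornerC, hornerX); ring.
rewrite hornerZ hornerM WE ga => H.
have : (r %| lead_coef g ^+ e * (d1 * d2))%Z.
  have -> : lead_coef g ^+ e * (d1 * d2) = r%:Z * (lead_coef g ^+ e * d2 * p1.[a] + q.[a] * m).
    apply/eqP; rewrite -subr_eq0; apply/eqP.
    transitivity (lead_coef g ^+ e * (d1 * d2 - r%:Z * d2 * p1.[a]) - q.[a] * (r%:Z * m));
      first by ring.
    by rewrite H subrr.
  by rewrite dvdz_mulr // dvdzz.
rewrite !prime_Euclid_dvdzM // (negPf rd1) (negPf rd2) !orbF.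
by move=> /(prime_Euclid_dvdzX pr); rewrite (negPf rc).
Qed.

Lemma prime_mem_split_ideal : Q r%:R.
Proof. by exists 1, 0; ring. Qed.

Lemma split_ideal_int (n : int) : Q n%:~R -> (r %| n)%Z.
Proof.
move=> Qn; apply/negPn/negP => /(prime_coprimez pr)[al [be E]]; apply: split_ideal_proper.
have [_ QD QM] := split_ideal_is_ideal.
have -> : 1 = al%:~R * n%:~R + be%:~R * r%:R :> OL by rewrite -[RHS]/(_ + _ * (r%:Z)%:~R)
  -!rmorphM -rmorphD E.
by apply: QD; apply: QM => //; apply: prime_mem_split_ideal.
Qed.

(** Every class modulo [Q] contains an integer, and [Q] meets the integers in the multiples of [r],
    so primality is Euclid's lemma for [r]. *)
Lemma split_ideal_prime : exists P : prime_idealr OL, [set` P] = Q.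
Proof.
have [Q0 QD QM] := split_ideal_is_ideal.
pose S : pred OL := fun y => `[< Q y >].
have SP : idealr_closed S.
  split; first exact/asboolP.
    by apply/asboolP/split_ideal_proper.
  by move=> z y1 y2 /asboolP Q1 /asboolP Q2; apply/asboolP/QD => //; apply: QM.
have Sprime : prime_idealr_closed S.
  move=> y z /asboolP Qyz; have [n Qn] := split_ideal_residue y;
    have [n' Qn'] := split_ideal_residue z.
  have : Q (n * n')%:~R.
    have -> : (n * n')%:~R = y * z - (z * (y - n%:~R) + n%:~R * (z - n'%:~R)) :> OL.
      by rewrite rmorphM /=; ring.
    exact: is_idealB split_ideal_is_ideal Qyz (QD _ _ (QM _ _ Qn) (QM _ _ Qn')). 
  move=> /split_ideal_int; rewrite prime_Euclid_dvdzM //.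
  have Qdiv (w : OL) (c : int) : Q (w - c%:~R) -> (r %| c)%Z -> w \in S.
    move=> Qw /dvdzP[b Eb]; apply/asboolP; rewrite -[w](subrK c%:~R); apply: QD => //.
    by rewrite Eb rmorphM; apply: QM; apply: prime_mem_split_ideal.
  by case/orP => rn; apply/orP; [left|right]; apply: Qdiv rn.
pose Si := GRing.isZmodClosed.Build OL S (idealr_closedB SP).
pose Sp := isProperIdeal.Build OL S (idealr_closed_nontrivial SP).
pose Sq := isPrimeIdealrClosed.Build OL S Sprime.
pose P : prime_idealr OL := HB.pack S Si Sp Sq.
exists P; apply/seteqP; split=> y /=; first by move=> /asboolP.
by move=> Qy; apply/asboolP.
Qed.

Lemma split_ideal_mul2 y z : Q y -> Q z -> ideal_exp Q 2 (y * z).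
Proof. by move=> Qy Qz; rewrite -[z]mulr1; do 2!apply: ideal_expS_mul => //. Qed.

(** Taylor expansion of [g] at [a] gives [0 = r * m + g'(a) * t] modulo [t ^ 2]; by [g_sep], [g'(a)]
    is invertible modulo [r], so [t] is an integer multiple of [r] modulo [Q ^ 2]. *)
Lemma root_shift_unramified : exists c : int, ideal_exp Q 2 (t - r%:R * c%:~R).
Proof.
have [q Eq] := poly_taylor1 g; have [q' Eq'] := poly_taylor1 q.
have g'a : g^`().[a] = q.[a].
  by rewrite {1}Eq !derivE !(hornerD, hornerN, hornerM, hornerC, hornerX, horner0); ring.
have ng' : ~~ (r %| g^`().[a])%Z.
  apply: contra rd => rg'; have := congr1 (fun p => p.[a]) g_sep.
  rewrite hornerD !hornerM hornerC => <-.
  by rewrite rpredD ?dvdz_mull // ga dvdz_mulr // dvdzz.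
have [al [be E]] := prime_coprimez pr ng'.
have ev0 : r%:R * m%:~R + t * ((q.[a])%:~R + t * int_eval x q') = 0.
  have := congr1 (int_eval x) Eq'; rewrite int_evalD int_evalC int_evalM -root_shift_eval => <-.
  have := gx; rewrite Eq int_evalD int_evalC int_evalM -root_shift_eval => <-.
  by rewrite ga rmorphM.
exists (- (al * m)).
have Et : t = al%:~R * (q.[a]%:~R * t) + be%:~R * r%:R * t.
  by rewrite mulrA -mulrDl -[r%:R]/((r%:Z)%:~R) -!rmorphM -rmorphD -g'a E mul1r.
have Eqt : (q.[a])%:~R * t = - (r%:R * m%:~R) - t * t * int_eval x q'.
  by apply/eqP; rewrite -subr_eq0 -ev0; apply/eqP; ring.
have -> : t - r%:R * (- (al * m))%:~R = be%:~R * (r%:R * t) - al%:~R * int_eval x q' * (t * t).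
  by rewrite {1}Et Eqt rmorphN rmorphM /=; ring.
have Qt : Q t by exists 0, 1; ring.
by apply: ideal_expB; apply: ideal_expM; apply: split_ideal_mul2 => //;
  apply: prime_mem_split_ideal.
Qed.

Lemma split_ideal_unramified y : Q y -> exists c : int, ideal_exp Q 2 (y - r%:R * c%:~R).
Proof.
move=> [y1 [y2 ->]]; have [c1 Q1] := split_ideal_residue y1;
  have [c2 Q2] := split_ideal_residue y2.
have [c Qc] := root_shift_unramified; have Qt : Q t by exists 0, 1; ring.
exists (c1 + c * c2).
have -> : r%:R * y1 + t * y2 - r%:R * (c1 + c * c2)%:~R =
    r%:R * (y1 - c1%:~R) + t * (y2 - c2%:~R) + c2%:~R * (t - r%:R * c%:~R).
  by rewrite rmorphD rmorphM /=; ring.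
apply: ideal_expD; last exact: ideal_expM.
by apply: ideal_expD; apply: split_ideal_mul2 => //; apply: prime_mem_split_ideal.
Qed.

(** Modulo [Q ^ 2], [y] is an integer multiple of [r], and the error is a sum of products of two
    elements of [Q]. Approximating both factors by induction gains one power of [Q] in each
    product. *)
Lemma split_ideal_power_unramified n y : Q y -> exists c :
  int, ideal_exp Q n.+2 (y - r%:R * c%:~R).
Proof.
elim: n y => [|n IH] y Qy; first exact: split_ideal_unramified.
have [c0 [s [sQ Es]]] := split_ideal_unramified Qy.
suff [c Qc] : exists c : int, ideal_exp Q n.+3 (\sum_(p <- s) p.1 * p.2 - r%:R * c%:~R).
  exists (c0 + c); rewrite (_ : _ - _ = y - r%:R * c0%:~R - r%:R * c%:~R); first by rewrite Es.
  by rewrite rmorphD /=; ring.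
rewrite big_seq; elim/big_ind: _ => [|y1 y2 [c1 H1] [c2 H2]|p ps].
- by exists 0; rewrite mulr0 subrr; case: (ideal_exp_ideal Q n.+3).
- exists (c1 + c2); have := ideal_expD H1 H2; congr (ideal_exp _ _ _).
  by rewrite rmorphD /=; ring.
have [Q1 [s2 [s2Q E2]]] := sQ p ps.
have Q2 : Q p.2.
  rewrite E2 big_seq; have [Q0 QD QM] := split_ideal_is_ideal.
  by elim/big_ind: _ => // p' /s2Q[Qp' _]; rewrite mulrC; apply: QM.
have [c1 H1] := IH _ Q1; have [c2 H2] := IH _ Q2.
exists (r%:Z * (c1 * c2)).
have -> : p.1 * p.2 - r%:R * (r%:Z * (c1 * c2))%:~R =
    p.1 * (p.2 - r%:R * c2%:~R) + c2%:~R * (r%:R * (p.1 - r%:R * c1%:~R)).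
  by rewrite !rmorphM /= -[(r%:Z)%:~R]/(r%:R); ring.
apply: ideal_expD; first exact: ideal_expS_mul.
by apply/ideal_expM/ideal_expS_mul => //; apply: prime_mem_split_ideal.
Qed.

Lemma split_prime_exists n : exists2 P : prime_idealr OL, r%:R \in P &
  forall y, exists c : nat, ideal_exp [set` P] n (y - c%:R).
Proof.
have [P EP] := split_ideal_prime; exists P; first by have := prime_mem_split_ideal; rewrite -EP.
move=> y; rewrite EP; have [c0 Qc0] := split_ideal_residue y.
have [c1 Qc1] := split_ideal_power_unramified n Qc0.
have r0 := prime_gt0 pr; pose c := c0 + r%:Z * c1.
have rn0 : (r ^ n)%N%:Z != 0 by rewrite eqz_nat -lt0n expn_gt0 r0.
(* Reducing modulo [r ^ n], which lies in [P ^ n], turns the integer [c] into a natural number. *)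
exists `|(c %% (r ^ n)%N%:Z)%Z|%N.
move: (divz_eq c (r ^ n)%N) (modz_ge0 c rn0).
move: (c %/ _)%Z (c %% _)%Z => w z Ec z0.
have -> : y - `|z|%N%:R = y - c0%:~R - r%:R * c1%:~R + w%:~R * r%:R ^+ n.
  have := congr1 (intr : int -> OL) Ec.
  rewrite /c !rmorphD !rmorphM /= -[(r%:Z)%:~R]/(r%:R) -pmulrn natrX => E.
  rewrite pmulrn gez0_abs // -[z%:~R](addKr (w%:~R * r%:R ^+ n)) -E.
  by ring.
apply: ideal_expD; last exact/ideal_expX/prime_mem_split_ideal.
by apply: ideal_exp_anti Qc1; rewrite ltnW.
Qed.

End SplitPrime.

(** For [n >= 2] the last clause says that [P] is of degree one and unramified over [r], in the form
    used below: the naturals exhaust the quotient by [P ^ n]. *)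
Definition split_prime n r (P : prime_idealr OL) := [/\ prime r, r%:R \in P &
  forall y, exists c : nat, ideal_exp [set` P] n (y - c%:R)].

Lemma split_primes_exist n N : exists r, (N < r)%N /\ exists P, split_prime n r P.
Proof.
have [x x_gen] := integral_generator.
have [g [gx sg g_min [d [u [v [d0 g_sep]]]]]] := minimal_int_poly x.
have [r [Nr pr [a ra]]] := poly_prime_divisors (N + `|lead_coef g| + `|d|) sg.
have ndvd (z : int) : z != 0 -> (`|z| < r)%N -> ~~ (r %| z)%Z.
  by move=> z0 zr; rewrite dvdzE absz_nat gtnNdvd ?absz_gt0.
have rc : ~~ (r %| lead_coef g)%Z.
  by apply: ndvd; [rewrite lead_coef_eq0 -size_poly_gt0 ltnW|lia].
have rd : ~~ (r %| d)%Z by apply: ndvd => //; lia.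
have /dvdzP[m Em] := ra; rewrite mulrC in Em.
have [P rP Pn] := split_prime_exists x_gen gx g_min g_sep pr rc rd Em n.
by exists r; split; [lia|exists P].
Qed.

End SplitPrimes.

(** * Factor maps *)

Section FreeSubsets.
Variables (K : fieldExtType rat) (k : nat).

Lemma free_subsetsS (S T : subsets K) :
  (forall x, S x -> T x) -> free_subsets k T -> free_subsets k S.
Proof.
move=> ST Tf P P0; have [a aT] := Tf P P0; exists a => x /aT.
by apply: contra => /ST.
Qed.

Lemma free_nil : (0 < k)%N -> free_subsets k (finite_subset (K := K) [::]).
Proof. by move=> k0 P _; exists 0. Qed.

Lemma free_singleton (x : int_ring K) : (0 < k)%N -> free_subsets k (finite_subset [:: x]).
Proof.
move=> k0 P _; exists (x - 1) => y Py; apply/negP; rewrite /finite_subset inE => /eqP E.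
by have := ideal_exp_sub k0 Py; rewrite E opprB addrCA subrr addr0 prime_ideal1.
Qed.

Definition free_elt (S : subsets K) (S_free : free_subsets k S) : set_type (@free_subsets K k) :=
  SigSub (mem_set S_free).

End FreeSubsets.

Section FactorMap.
Variables (K L : fieldExtType rat) (k l : nat).
Variable f : set_type (@free_subsets K k) -> set_type (@free_subsets L l).
Variable A : {additive int_ring K -> int_ring L}.
Hypothesis cf : continuous f.
Hypothesis fA : forall g x, f (free_translate g x) = free_translate (A g) (f x).
Local Notation OK := (int_ring K).
Local Notation OL := (int_ring L).

Lemma factor_eval S g b : val (f S) (A g + b) = val (f (free_translate (- g) S)) b.
Proof. by rewrite fA /= /translate raddfN opprK addrC. Qed.

(** Admissibility is quantified inside, so that a hit is a property of a bare list. *)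
Definition hits (T : seq OK) (b : OL) :=
  exists T_free : free_subsets k (finite_subset T), val (f (free_elt T_free)) b.

Lemma hits_truncate S b : val (f S) b ->
  exists2 T : seq OK, hits T b & forall x, x \in T -> val S x.
Proof.
move=> fSb; have [W WP] := continuous_local S b cf.
pose T := [seq w <- W | val S w].
have TS x : x \in T -> val S x by rewrite mem_filter => /andP[].
have T_free : free_subsets k (finite_subset T).
  exact: free_subsetsS TS (set_mem (valP S)).
exists T => //; exists T_free; rewrite WP // => w wW /=.
by rewrite /finite_subset mem_filter wW andbT.
Qed.

Lemma hits_glue n (T : 'I_n -> seq OK) (b : 'I_n -> OL) :
  (forall i, hits (T i) (b i)) -> exists D : seq OK, forall y : 'I_n -> OK,
    (forall i j, i != j -> y i - y j \notin D) ->
  forall U_free : free_subsets k (finite_subset (flatten [seq [seq y i + s | s <- T i] | i <-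
    enum 'I_n])),
  forall i, val (f (free_elt U_free)) (A (y i) + b i).
Proof.
move=> Tb; have /choice[W WP] i : exists W : seq OK, exists T_free :
  free_subsets k (finite_subset (T i)),
    val (f (free_elt T_free)) (b i) /\
    forall S', {in W, val S' =1 val (free_elt T_free)} -> val (f S') (b i) =
      val (f (free_elt T_free)) (b i).
  have [Tf Tfb] := Tb i; have [W WP] := continuous_local (free_elt Tf) (b i) cf.
  by exists W, Tf.
(* These are the differences [y i - y j] for which a point of the [j]-th piece enters the window of
   the [i]-th. When they are avoided, the union seen from [y i] agrees with [T i] on [W i]. *)
exists (flatten [seq [seq s - w | s <- T ij.2, w <- W ij.1] | ij <- enum {: 'I_n * 'I_n}]).
move=> y yD Uf i; have [Tf [Tfb WT]] := WP i.
rewrite factor_eval WT // => w wW /=; rewrite /translate opprK /finite_subset.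
apply/flattenP/idP => [[_ /mapP[j _ ->]] /mapP[s sT E]|wT]; last first.
  exists [seq y i + s | s <- T i]; first by apply/mapP; exists i; rewrite ?mem_enum.
  by rewrite addrC; apply: map_f.
have [ij|/negPn/eqP ij] := boolP (i != j); last first.
  by move: E; rewrite -ij addrC => /addrI ->; rewrite ij.
case/negP: (yD _ _ ij); apply/flattenP; exists [seq s - w | s <- T j, w <- W i].
  by apply/mapP; exists (i, j); rewrite ?mem_enum.
apply/allpairsP; exists (s, w); split=> //=.
by have -> : y i = y j + s - w; [rewrite -E addrAC subrr add0r|ring].
Qed.

Hypothesis A_surj : forall y, exists x, A x = y.
Hypothesis f_surj : forall T, exists S, f S = T.
Hypotheses (k0 : (0 < k)%N) (l0 : (0 < l)%N).

(* Translating a finite set by multiples of a kernel element pushes it to infinity without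
   changing its image, so a nontrivial kernel would make [f] constant on finite sets. *)
Lemma factor_ker h : A h = 0 -> h = 0.
Proof.
move=> Ah; apply/eqP/negPn/negP => h0.
pose E := free_elt (@free_nil K _ k0).
have f_const S : val (f S) 0 = val (f E) 0.
  have [W WP] := continuous_local S 0 cf; have [V VP] := continuous_local E 0 cf.
  pose T := [seq w <- W | val S w].
  have Tf : free_subsets k (finite_subset T).
    apply: free_subsetsS (set_mem (valP S)) => x.
    by rewrite /finite_subset mem_filter => /andP[].
  rewrite -(WP (free_elt Tf)); last by move=> w wW /=; rewrite /finite_subset mem_filter wW andbT.
  have [|[t v] i j _ _ _|j _ jP] := @exists_avoiding _ [seq (t, v) | t <- T, v <- V]
    (fun tv j => tv.1 = tv.2 + j%:R * h) (size [seq (t, v) | t <- T, v <- V]).+1 => //=.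
    move=> -> /addrI /eqP; rewrite -subr_eq0 -mulrBl int_ring_mulf_eq0 (negPf h0) orbF subr_eq0.
    by rewrite !pmulrn (inj_eq (@int_ring_intr_inj K)) => /eqP[].
  rewrite -(VP (free_translate (- (j%:R * h)) (free_elt Tf))).
    by rewrite -factor_eval mulr_natl raddfMn /= Ah mul0rn addr0.
  move=> v vV /=; rewrite /translate opprK /finite_subset; apply/negbTE/negP => vT.
  by apply: (jP (v + j%:R * h, v)) => //; apply/allpairsP; exists (v + j%:R * h, v).
have [S0 fS0] := f_surj (free_elt (free_singleton (0 : OL) l0)).
have [S1 fS1] := f_surj (free_elt (@free_nil L _ l0)).
have := f_const S0; rewrite -(f_const S1) fS0 fS1 /=.
by rewrite /finite_subset inE eqxx.
Qed.

Lemma factor_inverse : exists B : OL -> OK, [/\ cancel A B, cancel B A,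
  forall x y, B (x + y) = B x + B y, forall x y, B (x - y) = B x - B y &
  forall n x, B (n%:R * x) = n%:R * B x].
Proof.
have /choice[B BK] := A_surj; exists B.
have AI : injective A.
  by move=> x y /eqP; rewrite -subr_eq0 -raddfB => /eqP/factor_ker/eqP; rewrite subr_eq0 => /eqP.
split=> //.
- by move=> x; apply: AI; rewrite BK.
- by move=> x y; apply: AI; rewrite raddfD /= !BK.
- by move=> x y; apply: AI; rewrite raddfB /= !BK.
- by move=> n x; apply: AI; rewrite !mulr_natl raddfMn /= !BK.
Qed.

(** * The additive inverse [B]: prime powers, the shift, exponents and products *)

Section Inverse.
Variable B : OL -> OK.
Hypotheses (AK : cancel A B) (BK : cancel B A).
Hypothesis BD : forall x y, B (x + y) = B x + B y.
Hypothesis BB : forall x y, B (x - y) = B x - B y.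
Hypothesis BM : forall n x, B (n%:R * x) = n%:R * B x.

Lemma factor_natM n x : A (n%:R * x) = n%:R * A x.
Proof. by rewrite !mulr_natl raddfMn. Qed.

Lemma inverse_nat n : B n%:R = n%:R * B 1.
Proof. by rewrite -BM mulr1. Qed.

(** Modulo [P] and [P'] simultaneously, every element is a multiple [n * B 1]. For an element of [P]
    that is 1 modulo [P'], [r] must divide [n], which places it in [P'] as well. *)
Lemma cyclic_ideal_unique (Q : prime_idealr OL) (P P' : prime_idealr OK) r :
  prime r -> r%:R \in P -> r%:R \in P' ->
  (forall x, exists n : nat, ideal_exp [set` Q] l (x - n%:R)) ->
  (forall x, ideal_exp [set` Q] l x -> ideal_exp [set` P] k (B x)) ->
  (forall x, ideal_exp [set` Q] l x -> ideal_exp [set` P'] k (B x)) -> P =i P'.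
Proof.
move=> pr rP rP' cyc QP QP'; apply: contrapT => PP'.
have r0 := prime_gt0 pr.
have [u uP uP'] := distinct_prime_ideals (nonzero_ideal_nat r0 rP) (nonzero_ideal_nat r0 rP') PP'.
have dec x : exists n : nat, x - n%:R * B 1 \in P /\ x - n%:R * B 1 \in P'.
  have [n nQ] := cyc (A x); exists n.
  have -> : x - n%:R * B 1 = B (A x - n%:R) by rewrite BB AK inverse_nat.
  by split; apply: (ideal_exp_sub k0); [apply: QP|apply: QP'].
have [n [nP nP']] := dec u.
have BP : B 1 \notin P.
  apply/negP => BP; have [m [mP _]] := dec 1.
  suff : 1 \in P by rewrite prime_ideal1.
  by rewrite -[1](subrK (m%:R * B 1)); apply: rpredD => //; apply: idealMr.
have : n%:R * B 1 \in P by rewrite -[_ * _](subKr u); apply: rpredB.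
rewrite prime_idealrM (negPf BP) orbF (prime_ideal_dvdn _ pr rP) => rn.
have : n%:R * B 1 \in P' by rewrite mulrC idealMr // (prime_ideal_dvdn _ pr rP').
move=> /(rpredD nP'); rewrite subrK => /(rpredD uP').
by rewrite subrK prime_ideal1.
Qed.

(* Write [M] for the image of [Q ^ l] under [B], and suppose that no [P] above [r] is as claimed.
   Then for every class modulo [Q ^ l] one can place a copy of some [T] so that the image gets a
   point in that class, while the union of the copies avoids [0] modulo [P ^ k] for all [P] above
   [r]: if [M] is not contained in [P ^ k], a random point of a coset of [M] avoids the relevant
   classes since [r] is large; the unique [P] with [M] inside [P ^ k], if it exists, is handled by
   the choice of [T]. The image of this union then meets all classes modulo [Q ^ l]. *)
Lemma hits_common_residue (Q : prime_idealr OL) r (F : seq (seq OK * OL)) p0 :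
  prime r -> r%:R \in Q -> (\dim {:K} < r)%N ->
  (forall x, exists n : nat, ideal_exp [set` Q] l (x - n%:R)) ->
  p0 \in F ->
  (forall p, p \in F -> hits p.1 p.2 /\ (\dim {:K} * size p.1 < r)%N) ->
  exists P : prime_idealr OK, [/\ r%:R \in P,
    forall x, ideal_exp [set` Q] l x -> ideal_exp [set` P] k (B x) &
    exists x, forall p, p \in F -> exists2 s, s \in p.1 & ideal_exp [set` P] k (x - B p.2 + s)].
Proof.
move=> pr rQ nr cyc p0F FP; apply: contrapT => noP.
have r0 := prime_gt0 pr.
pose M : set OK := [set x | ideal_exp [set` Q] l (A x)].
have M0 : M 0 by rewrite /M /= raddf0; case: (ideal_exp_ideal [set` Q] l).
have MD x y : M x -> M y -> M (x + y) by rewrite /M /= raddfD; apply: ideal_expD.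
have Mn n x : M x -> M (n%:R * x) by rewrite /M /= factor_natM; apply: ideal_expM.
have MB x : ideal_exp [set` Q] l x -> M (B x) by rewrite /M /= BK.
have [t [P [tK rP dP allP]]] := prime_ideals_above_prime K pr.
pose J (i : 'I_t) : bool := `[< exists2 m, M m & ~ ideal_exp [set` P i] k m >].
have nJ i : ~~ J i -> forall m, M m -> ideal_exp [set` P i] k m.
  move=> /asboolP nJ m Mm; apply: contrapT => nP; apply: nJ.
  by exists m.
(* At position [n * B 1 - B p.2] the image point of [p] falls on [n]. If every pair of [F] met 0 at
   the exceptional prime, [n * B 1] would be the common [x] of the claim. *)
have pick (n : nat) : exists2 p, p \in F & forall i s, ~~ J i -> s \in p.1 ->
    ~ ideal_exp [set` P i] k (n%:R * B 1 - B p.2 + s).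
  have [[i0 nJi0]|allJ] := pselect (exists i, ~~ J i); last first.
    by exists p0 => // i s nJi; case: allJ; exists i.
  apply: contrapT => nop; apply: noP; exists (P i0); split=> //.
    by move=> x /MB; apply: nJ.
  exists (n%:R * B 1) => p pF; apply: contrapT => nos; apply: nop; exists p => // i s nJi sp Ps.
  apply: nos; exists s => //; suff E : P i =i P i0 by rewrite -(eq_ideal_exp _ E).
  by apply: (cyclic_ideal_unique pr (rP i) (rP i0) cyc) => x /MB; apply: nJ.
have place (n : nat) : exists px : (seq OK * OL) * OK,
    [/\ px.1 \in F, M (px.2 + B px.1.2 - n%:R * B 1) &
      forall i s, s \in px.1.1 -> ~ ideal_exp [set` P i] k (px.2 + s)].
  have [p pF pP] := pick n; have [_ pr'] := FP p pF.
  have JM i : J i -> exists2 m, M m & ~ ideal_exp [set` P i] k m by move=> /asboolP.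
  have [||m Mm mP] := exists_outside_cosets pr rP M0 MD Mn JM (n%:R * B 1 - B p.2) (S := p.1).
  - exact: leq_ltn_trans nr.
  - by apply: leq_ltn_trans pr'; rewrite leq_mul2r tK orbT.
  exists (p, n%:R * B 1 - B p.2 + m); split=> //=.
    by rewrite (_ : _ + B p.2 - _ = m) //; ring.
  move=> i s sp; have [Ji|nJi] := boolP (J i); first exact: mP.
  move=> Ps; apply: (pP i s nJi sp).
  have := ideal_expB Ps (nJ i nJi m Mm); congr (ideal_exp _ _ _); ring.
have [px pxP] := choice place.
pose N := (r ^ l)%N; pose T (i : 'I_N) := (px i).1.1; pose b (i : 'I_N) := (px i).1.2.
have hT i : hits (T i) (b i) by have [pF _ _] := pxP i; case: (FP _ pF).
have [D DP] := hits_glue hT.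
(* The exponent [k + l] makes the moves of the pieces harmless on both sides: [k] for the primes of
   [O_K] above [r], and [l] for the classes of the image points modulo [Q ^ l]. *)
have [i|P' i s rP' sT|y [yx U_free yD]] :=
  @place_pieces K k r (k + l) N T (fun i => (px i).2) D pr (leq_addr _ _) k0.
- by have [Tf _] := hT i.
- have [j Ej] := allP _ rP'; rewrite (eq_ideal_exp _ Ej).
  by have [_ _] := pxP i; apply.
have fU := DP y yD U_free.
have [a aP] := set_mem (valP (f (free_elt U_free))) Q (nonzero_ideal_nat r0 rQ).
have [n nP] := cyc a.
have rlQ x : ideal_exp [set` Q] l (r%:R ^+ l * x) by rewrite mulrC; apply: ideal_expX.
have nN : (n %% N < N)%N by rewrite ltn_mod expn_gt0 r0.
pose i := Ordinal nN; have := fU i; apply/negP/aP.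
have [_ Mi _] := pxP i; have [z Ez] := yx i.
have -> : A (y i) + b i - a = A (y i - (px i).2) + A ((px i).2 + B (b i) -
  i%:R * B 1) + (i%:R - n%:R) - (a - n%:R).
  by rewrite !(raddfB A) raddfD /= factor_natM !BK mulr1; ring.
apply: ideal_expB => //; apply: ideal_expD; first apply: ideal_expD => //.
  by rewrite Ez -natrX factor_natM natrX exprD -mulrA; apply/ideal_expM/rlQ.
rewrite [X in _ - X%:R](divn_eq n N) natrD opprD addrCA subrr addr0 natrM natrX.
by rewrite -mulNr mulrC; apply: rlQ.
Qed.

Lemma hits_exists : exists p, hits p.1 p.2.
Proof.
have [S fS] := f_surj (free_elt (free_singleton (0 : OL) l0)).
have [|T Tb _] := @hits_truncate S 0; last by exists (T, 0).
by rewrite fS /= /finite_subset inE.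
Qed.

(** A nonzero [z] divides a positive integer, which belongs to no prime above a larger rational
    prime [r]. *)
Lemma large_primes_avoid (Z : seq OK) : exists N : nat, forall (P : prime_idealr OK) r,
  prime r -> r%:R \in P -> (N < r)%N -> forall z, z \in Z -> z \in P -> z = 0.
Proof.
elim: Z => [|z Z [N NP]]; first by exists 0.
have [->|z0] := eqVneq z 0.
  exists N => P r pr rP Nr z'; rewrite inE => /predU1P[//|]; exact: NP pr rP Nr z'.
have [c c0 [w Ew]] := int_ring_dvd_nat z0.
exists (N + c)%N => P r pr rP Nr z'; rewrite inE => /predU1P[->|]; last first.
  by apply: NP pr rP _ z'; apply: leq_ltn_trans Nr; rewrite leq_addr.
move=> /(idealMr w); rewrite -Ew (prime_ideal_dvdn _ pr rP) => /(dvdn_leq c0).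
by move: Nr; rewrite ltnNge => /negP nr rc; case: nr; rewrite (leq_trans rc) // leq_addl.
Qed.

(* A shift [c] compatible with all pairs [(T, b)] is found among the finitely many ones compatible
   with a given pair; were there none, finitely many pairs would have no common shift,
   contradicting [hits_common_residue] modulo a large prime. *)
Lemma hits_shift : exists c, forall T b, hits T b -> exists2 s, s \in T & b = c + A s.
Proof.
have [[T0 b0] /= h0] := hits_exists; apply: contrapT => noc.
have /choice[F FP] (c : OL) : exists p :
  seq OK * OL, hits p.1 p.2 /\ forall s, s \in p.1 -> p.2 <> c + A s.
  apply: contrapT => nop; apply: noc; exists c => T b Tb; apply: contrapT => nos.
  by apply: nop; exists (T, b); split=> // s sT Eb; apply: nos; exists s.
(* A shift compatible with [(T0, b0)] lies in [C], and [F c] is a pair refuting [c]; so the finite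
   list [Fs] has no common shift. *)
pose C := [seq b0 - A s | s <- T0]; pose Fs := (T0, b0) :: map F C.
(* None of these elements is 0, since [F c] refutes [c]; a prime above a large [r] therefore
   contains none of them. *)
pose Z := flatten [seq [seq B c - B (F c).2 + s | s <- (F c).1] | c <- C].
have [N1 N1P] := large_primes_avoid Z.
pose N2 := (\max_(p <- Fs) (\dim {:K} * size p.1))%N.
have [r [rN [Q [pr rQ cyc]]]] := split_primes_exist L l (N1 + N2 + \dim {:K}).
have [||P [rP QP [x xP]]] := @hits_common_residue Q r Fs (T0, b0) pr rQ _ cyc (mem_head _ _).
- by apply: leq_ltn_trans rN; rewrite leq_addl.
- move=> p pF; split.
    by move: pF; rewrite inE => /predU1P[->//|/mapP[c _ ->]]; case: (FP c).
  have : (\dim {:K} * size p.1 <= N2)%N by apply: (@leq_bigmax_seq _ _ _ (fun p :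
    seq OK * OL => \dim {:K} * size p.1)%N).
  by lia.
have [s0 s0T Ps0] := xP _ (mem_head _ _); rewrite /= in s0T Ps0.
have cC : b0 - A s0 \in C by apply: map_f.
have FcF : F (b0 - A s0) \in Fs by rewrite inE map_f ?orbT.
have [s sT Ps] := xP _ FcF; have [_ /(_ s sT)] := FP (b0 - A s0); apply.
have zZ : B (b0 - A s0) - B (F (b0 - A s0)).2 + s \in Z.
  apply/flattenP; eexists; first by apply: map_f cC.
  exact: map_f.
have N1r : (N1 < r)%N by lia.
have : B (b0 - A s0) - B (F (b0 - A s0)).2 + s \in P.
  apply: (ideal_exp_sub k0); have := ideal_expB Ps Ps0; congr (ideal_exp _ _ _).
  by rewrite BB AK; ring.
move/(N1P P r pr rP N1r _ zZ)/(congr1 A) => E.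
rewrite raddf0 raddfD (raddfB A) /= !BK addrAC in E.
by apply/eqP; rewrite eq_sym -subr_eq0 E.
Qed.

(** The points [x] with [c + A x] in [f S'] all lie in [S'], so they miss a class modulo each
    [P ^ k] because [S'] does. *)
Lemma factor_shift : exists c, forall S : set_type (@free_subsets L l),
  forall P : prime_idealr OK, nonzero_ideal P ->
  exists a, forall x, ideal_exp [set` P] k (x - a) -> ~~ val S (c + A x).
Proof.
have [c cP] := hits_shift; exists c => S P P0.
have [S' <-] := f_surj S; have [a aP] := set_mem (valP S') P P0.
exists a => x /aP; apply: contra => /hits_truncate[T Tb TS'].
have [s sT /addrI /(congr1 B)] := cP _ _ Tb; rewrite !AK => ->.
exact: TS'.
Qed.

(** Otherwise each class modulo [P ^ k] could receive, through [A] and the shift [c], a point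
    avoiding [Q ^ l] for all [Q] above [r]. Such points can be moved into an admissible set in [O_L]
    whose preimage meets every class, against [factor_shift]. *)
Lemma prime_power_image (P : prime_idealr OK) r : prime r -> r%:R \in P -> (\dim {:L} < r)%N ->
  exists2 Q : prime_idealr OL, r%:R \in Q &
    forall x, ideal_exp [set` P] k x -> ideal_exp [set` Q] l (A x).
Proof.
move=> pr rP nr; have r0 := prime_gt0 pr; have P0 := nonzero_ideal_nat r0 rP.
apply: contrapT => noQ; have [c cP] := factor_shift.
have [t [Q [tL rQ dQ allQ]]] := prime_ideals_above_prime L pr.
pose M : set OL := [set y | ideal_exp [set` P] k (B y)].
have B0 : B 0 = 0 by rewrite -(subrr 0) BB subrr.
have M0 : M 0 by rewrite /M /= B0; case: (ideal_exp_ideal [set` P] k).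
have MD x y : M x -> M y -> M (x + y) by rewrite /M /= BD; apply: ideal_expD.
have Mn n x : M x -> M (n%:R * x) by rewrite /M /= BM; apply: ideal_expM.
have MQ i : xpredT i -> exists2 m, M m & ~ ideal_exp [set` Q i] l m.
  move=> _; apply: contrapT => nom; apply: noQ; exists (Q i) => // x Px.
  by apply: contrapT => nQ; apply: nom; exists (A x) => //; rewrite /M /= AK.
have rk0 : (0 < r ^ k)%N by rewrite expn_gt0 r0.
have [s sP] := finite_residues K rk0.
have place (i : 'I_(size s)) : exists y : OL, M (y - c - A s`_i) /\
    forall j, ~ ideal_exp [set` Q j] l y.
  have [||m Mm mP] := exists_outside_cosets pr rQ M0 MD Mn MQ (c + A s`_i) (S := [:: 0]).
  - exact: leq_ltn_trans nr.
  - by rewrite muln1; apply: leq_ltn_trans nr.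
  exists (c + A s`_i + m); split; first by rewrite (_ : _ - _ - _ = m) //; ring.
  by move=> j Qj; apply: (mP j 0); rewrite ?mem_head // addr0.
have [x xP] := choice place.
have [i|P' i z rP' zT|y [yx U_free _]] :=
  @place_pieces L l r (l + k) (size s) (fun=> [:: 0]) x [::] pr (leq_addr _ _) l0.
- exact: free_singleton.
- move: zT; rewrite inE => /eqP ->; rewrite addr0.
  by have [j Ej] := allQ _ rP'; rewrite (eq_ideal_exp _ Ej); case: (xP i).
have [a aP] := cP (free_elt U_free) P P0.
have [a' /nthP -/(_ 0)[i0 i0s Ea'] [z Ez]] := sP a.
pose i := Ordinal i0s; have [z' Ez'] := yx i; have [Mx _] := xP i.
have rkP u : ideal_exp [set` P] k (r%:R ^+ k * u) by rewrite mulrC; apply: ideal_expX.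
have := aP (B (y i - c)); rewrite BK addrCA subrr addr0 => H.
have /H/negP : ideal_exp [set` P] k (B (y i - c) - a).
  have -> : B (y i - c) - a = B (y i - x i) + B (x i - c - A s`_i) - (a - a').
    by rewrite !BB AK /= Ea'; ring.
  apply: ideal_expB; last by rewrite Ez natrX.
  apply: ideal_expD => //; rewrite Ez' exprD -mulrA mulrCA -natrX BM natrX.
  exact: rkP.
apply; apply/flattenP; exists [seq y i + u | u <- [:: 0]].
  by apply/mapP; exists i; rewrite ?mem_enum.
by rewrite /= addr0 mem_head.
Qed.

Lemma hits_split_prime N : exists r (Q : prime_idealr OL) (P :
  prime_idealr OK), [/\ (N < r)%N, split_prime l r Q, r%:R \in P &
  forall x, ideal_exp [set` Q] l x -> ideal_exp [set` P] k (B x)].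
Proof.
have [p hp] := hits_exists.
have [r [rN [Q [pr rQ cyc]]]] := split_primes_exist L l (N + \dim {:K} * size p.1 + \dim {:K}).
have [||P [rP QP _]] := @hits_common_residue Q r [:: p] p pr rQ _ cyc (mem_head _ _).
- by lia.
- move=> p'; rewrite inE => /eqP ->; split=> //.
  by apply: leq_ltn_trans rN; rewrite -addnA addnCA leq_addr.
by exists r, Q, P; split=> //; lia.
Qed.

(** The quotient by [P ^ k] is cyclic, generated by [B 1], and killed by [r ^ l], so [k <= l]; the
    quotient by [Q' ^ l] is cyclic, generated by 1, and killed by [r ^ k], so [l <= k]. *)
Lemma factor_exponent : k = l.
Proof.
have [r [Q [P [Nr [pr rQ cyc] rP QP]]]] := hits_split_prime (\dim {:L}).
have [Q' rQ' PQ'] := prime_power_image pr rP Nr.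
have r0 := prime_gt0 pr.
apply/eqP; rewrite eqn_leq; apply/andP; split.
- apply: (ideal_exp_cyclic_leq (w := B 1) (nonzero_ideal_nat r0 rP) pr rP).
    move=> x; have [n /QP] := cyc (A x); exists n.
    by rewrite -[x in x - _]AK -inverse_nat -BB.
  rewrite -[_ ^+ l]AK; apply: QP; rewrite -natrX -[_%:R]mulr1 factor_natM natrX mulrC.
  exact: ideal_expX.
- apply: (ideal_exp_cyclic_leq (w := 1) (nonzero_ideal_nat r0 rQ') pr rQ').
    move=> x; have [n /QP/PQ'] := cyc x; exists n.
    by rewrite mulr1 -[_ - _]BK.
  rewrite -[_ ^+ k]BK; apply: PQ'; rewrite -natrX inverse_nat natrX mulrC.
  exact: ideal_expX.
Qed.

(* Elements of [O_L] are integers modulo [Q ^ l], so elements of [O_K] are integer multiples of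
   [B 1] modulo [P]; hence the two sides agree modulo infinitely many primes [P]. *)
Lemma factor_inverse_mul x y : B x * B y = B 1 * B (x * y).
Proof.
apply/eqP; rewrite -subr_eq0; apply/eqP; set z := _ - _.
have [N NP] := large_primes_avoid [:: z].
have [r [Q [P [Nr [pr rQ cyc] rP QP]]]] := hits_split_prime N.
apply: (NP P r pr rP Nr); first exact: mem_head.
have [n nx] := cyc x; have [m my] := cyc y.
have mxy : ideal_exp [set` Q] l (x * y - (n * m)%:R).
  have := ideal_expD (ideal_expM y nx) (ideal_expM n%:R my); congr (ideal_exp _ _ _).
  by rewrite natrM; ring.
have BP u c : ideal_exp [set` Q] l (u - c%:R) -> B u - c%:R * B 1 \in P.
  by move/QP; rewrite BB inverse_nat => /(ideal_exp_sub k0).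
have -> : z = B y * (B x - n%:R * B 1) + n%:R * B 1 * (B y - m%:R * B 1)
    - B 1 * (B (x * y) - (n * m)%:R * B 1).
  by rewrite /z natrM; ring.
by rewrite rpredB // ?rpredD // idealMr // BP.
Qed.

End Inverse.
End FactorMap.

(** * From additive maps to field isomorphisms *)

Section FieldIsomorphism.
Variables (K L : fieldExtType rat).
Local Notation OK := (int_ring K).
Local Notation OL := (int_ring L).

Lemma exists_rmorphism (R S : nzRingType) (f : R -> S) :
  (forall x y, f (x - y) = f x - f y) -> (forall x y, f (x * y) = f x * f y) -> f 1 = 1 ->
  exists g : {rmorphism R -> S}, g =1 f.
Proof.
move=> fB fM f1.
pose Fz := GRing.isZmodMorphism.Build R S f fB.
pose Fm := GRing.isMonoidMorphism.Build R S f (conj f1 fM).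
pose F : {rmorphism R -> S} := HB.pack f Fz Fm.
by exists F.
Qed.

Lemma field_rmorphism_inverse (F E : fieldType) (f : {rmorphism F -> E}) (g : E -> F) :
  cancel g f -> exists h : {rmorphism E -> F}, h =1 g.
Proof.
move=> gK; apply: exists_rmorphism; first by move=> x y; apply: (fmorph_inj f);
  rewrite rmorphB !gK.
  by move=> x y; apply: (fmorph_inj f); rewrite rmorphM !gK.
by apply: (fmorph_inj f); rewrite rmorph1 gK.
Qed.

Variable B : OL -> OK.
Hypothesis B_inj : injective B.
Hypothesis B_surj : forall y, exists x, B x = y.
Hypothesis BB : forall x y, B (x - y) = B x - B y.
Hypothesis BM : forall n x, B (n%:R * x) = n%:R * B x.
Hypothesis BBM : forall x y, B x * B y = B 1 * B (x * y).

(* [B / B 1] is a ring morphism on [O_L]; extend it to fractions. *)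
Lemma field_isomorphic_of_additive : field_isomorphic K L.
Proof.
have /choice[nd ndP] (x : L) : exists zd : OL * nat, (0 < zd.2)%N /\ val zd.1 = zd.2%:R * x.
  by have [d d0 [z Ez]] := int_ring_multiple x; exists (z, d).
have C0 : val (B 1) != 0.
  have B0 : B 0 = 0 by rewrite -(subrr 0) BB subrr.
  rewrite -(rmorph0 (val : {rmorphism OK -> K})) (inj_eq val_inj) -B0 (inj_eq B_inj).
  exact: oner_neq0.
pose phi x : K := val (B (nd x).1) / ((nd x).2%:R * val (B 1)).
have nz d : (0 < d)%N -> (d%:R : K) != 0 by rewrite natr_fieldExt_eq0 -lt0n.
have nzL d : (0 < d)%N -> (d%:R : L) != 0 by rewrite natr_fieldExt_eq0 -lt0n.
have vM (F : fieldExtType rat) n (z : int_ring F) : val (n%:R * z) = n%:R * val z.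
  by rewrite rmorphM /= -[int_ring_val n%:R]/(val _) int_ring_val_natr.
have vB (F : fieldExtType rat) (z1 z2 : int_ring F) : val (z1 - z2) = val z1 - val z2.
  by rewrite rmorphB.
have vMM (F : fieldExtType rat) (z1 z2 : int_ring F) : val (z1 * z2) = val z1 * val z2.
  by rewrite rmorphM.
(* The value does not depend on the fraction representing [x], so each operation may use its own
   common denominator. *)
have phiE d z x : (0 < d)%N -> val z = d%:R * x -> phi x = val (B z) / (d%:R * val (B 1)).
  move=> d0 Ez; have [e0 Ee] := ndP x.
  have E : (nd x).2%:R * z = d%:R * (nd x).1.
    by apply: val_inj; rewrite !vM Ez Ee mulrCA.
  apply/eqP; rewrite /phi eqr_div ?mulf_neq0 ?nz //; apply/eqP.
  have := congr1 (fun z => val (B z)) E; rewrite !BM !vM => E'.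
  by rewrite [LHS]mulrA [RHS]mulrA [_ * d%:R]mulrC -E' [_ * _%:R]mulrC.
have [|||F FE] := @exists_rmorphism L K phi.
- move=> x y; have [dx0 Ex] := ndP x; have [dy0 Ey] := ndP y.
  rewrite (@phiE ((nd x).2 * (nd y).2)%N ((nd y).2%:R * (nd x).1 - (nd x).2%:R * (nd y).1)).
  + rewrite BB !BM vB !vM natrM /phi.
    by field; rewrite C0 !nz.
  + by rewrite muln_gt0 dx0.
  + by rewrite vB !vM Ex Ey natrM; ring.
- move=> x y; have [dx0 Ex] := ndP x; have [dy0 Ey] := ndP y.
  rewrite (@phiE ((nd x).2 * (nd y).2)%N ((nd x).1 * (nd y).1)).
  + have := congr1 val (BBM (nd x).1 (nd y).1); rewrite !vMM => E.
    rewrite /phi mulf_div natrM E.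
    by field; rewrite C0 !nz.
  + by rewrite muln_gt0 dx0.
  + by rewrite natrM vMM Ex Ey; ring.
- by rewrite (@phiE 1 1) ?mul1r ?divff ?rmorph1.
suff /choice[G GK] y : exists x, F x = y.
  have [H HE] := field_rmorphism_inverse GK.
  exists H; exists F => x; rewrite HE ?GK //.
  by apply: (fmorph_inj F); rewrite GK.
have [e e0 [w Ew]] := int_ring_multiple (y * val (B 1)).
have [z Ez] := B_surj w; exists (val z / e%:R); rewrite FE (phiE e z) //.
  by rewrite Ez Ew; field; rewrite C0 nz.
by rewrite mulrC divfK // nzL.
Qed.
End FieldIsomorphism.

(** * Conjugacy from field isomorphisms *)

Section Conjugacy.

Lemma ideal_exp_image (R S : comNzRingType) (h : {rmorphism R -> S}) (I : set R) (J : set S) n x :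
  (forall y, I y -> J (h y)) -> ideal_exp I n x -> ideal_exp J n (h x).
Proof.
move=> IJ; elim: n x => //= n IH _ [s [sI ->]].
exists [seq (h p.1, h p.2) | p <- s]; split.
  by move=> _ /mapP[p /sI[p1 p2] ->]; split; [apply: IJ|apply: IH].
by rewrite rmorph_sum big_map; apply: eq_bigr => p _; rewrite rmorphM.
Qed.

Lemma prime_ideal_preimage (R S : comNzRingType) (h : {rmorphism R -> S}) (P : prime_idealr S) :
  exists Q : prime_idealr R, forall x, (x \in Q) = (h x \in P).
Proof.
pose U : pred R := fun x => h x \in P.
have UE x : (x \in U) = (h x \in P) by [].
have UP : idealr_closed U.
  split; first by rewrite UE rmorph0 rpred0.
    by rewrite UE rmorph1 prime_ideal1.
  by move=> z y1 y2; rewrite !UE rmorphD rmorphM => Q1 Q2; rewrite rpredD ?idealMr.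
have Uprime : prime_idealr_closed U.
  by move=> y z; rewrite !UE rmorphM prime_idealrM.
pose Ui := GRing.isZmodClosed.Build R U (idealr_closedB UP).
pose Up := isProperIdeal.Build R U (idealr_closed_nontrivial UP).
pose Uq := isPrimeIdealrClosed.Build R U Uprime.
pose Q : prime_idealr R := HB.pack U Ui Up Uq.
by exists Q.
Qed.

(** A class missed modulo the power of the pulled-back prime [Q] is carried by [h] to a class missed
    modulo that of [P]. *)
Lemma free_subsets_transport (K L : fieldExtType rat) k (S : subsets K)
    (h : {rmorphism int_ring K -> int_ring L}) (h' : {rmorphism int_ring L -> int_ring K}) :
  cancel h h' -> cancel h' h -> free_subsets k S -> free_subsets k (S \o h').
Proof.
move=> hK h'K Sfree P [y yP y0]; have [Q QP] := prime_ideal_preimage h P.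
have [|a aP] := Sfree Q.
  exists (h' y); first by rewrite QP h'K.
  by rewrite -(inj_eq (can_inj hK)) h'K rmorph0.
exists (h a) => x Px; apply: aP.
rewrite -[a]hK -rmorphB; apply: ideal_exp_image Px => z /= zP.
by rewrite QP h'K.
Qed.

Lemma int_ring_rmorph (K L : fieldExtType rat) (f : {rmorphism K -> L}) :
  exists h : {rmorphism int_ring K -> int_ring L}, forall x, val (h x) = f (val x).
Proof.
have fI (x : int_ring K) : f (val x) \in @algebraic_integer L.
  have /algebraic_integerP[p mp px] := valP x; apply/algebraic_integerP; exists p => //.
  move: px => /(rmorph_root f); rewrite -map_poly_comp.
  by rewrite (eq_map_poly (g := intr)) // => z /=; rewrite rmorph_int.
have [|||h hE] := @exists_rmorphism (int_ring K) (int_ring L) (fun x => IntRing (fI x)).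
- by move=> x y; apply: val_inj; rewrite /= !rmorphB.
- by move=> x y; apply: val_inj; rewrite /= !rmorphM.
- by apply: val_inj; rewrite /= !rmorph1.
by exists h => x; rewrite hE.
Qed.

Lemma field_isomorphic_conjugate (K L : fieldExtType rat) k :
  field_isomorphic K L -> conjugate (free_system K k) (free_system L k).
Proof.
move=> [f [g fK gK]].
have [G GE] := field_rmorphism_inverse gK.
have [h hE] := int_ring_rmorph f; have [h' h'E] := int_ring_rmorph G.
have hK : cancel h h' by move=> x; apply: val_inj; rewrite h'E hE GE fK.
have h'K : cancel h' h by move=> x; apply: val_inj; rewrite hE h'E GE gK.
pose F (S : phase (free_system K k)) : phase (free_system L k) :=
  free_elt (free_subsets_transport hK h'K (set_mem (valP S))).
pose F' (S : phase (free_system L k)) : phase (free_system K k) :=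
  free_elt (free_subsets_transport h'K hK (set_mem (valP S))).
have cF : continuous F by apply: (@coordinatewise_continuous K L k k F h').
exists F, h; split.
- split=> // a S; apply: val_inj; apply/funext => x /=.
  by rewrite /translate /= rmorphB hK.
- by exists h'.
split=> //; exists F'; split.
- by apply: (@coordinatewise_continuous L K k k F' h).
- by move=> S; apply: val_inj; apply/funext => x /=; rewrite hK.
- by move=> S; apply: val_inj; apply/funext => x /=; rewrite h'K.
Qed.

End Conjugacy.

Lemma factor_field_isomorphic (K L : fieldExtType rat) (k l : nat) : (0 < k)%N -> (0 < l)%N ->
  is_factor_of (free_system L l) (free_system K k) -> field_isomorphic K L /\ k = l.
Proof.
move=> k0 l0 [f [A [[cf fA] A_surj f_surj]]].
have [B [AK BK BD BB BM]] := factor_inverse cf fA A_surj f_surj k0 l0.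
split; last exact: (factor_exponent cf fA f_surj k0 l0 AK BK BD BB BM).
apply: (@field_isomorphic_of_additive K L B) => //.
- exact: can_inj BK.
- by move=> y; exists (A y).
- exact: (factor_inverse_mul cf fA f_surj k0 l0 AK BK BB BM).
Qed.

Theorem theorem1p4 (K L : fieldExtType rat) (k l : nat)
    (hk : (2 <= k)%N) (hl : (2 <= l)%N) :
  (conjugate (free_system K k) (free_system L l) <->
     is_factor_of (free_system L l) (free_system K k)) /\
  (is_factor_of (free_system L l) (free_system K k) <->
     field_isomorphic K L /\ k = l).
Proof.
have ab : conjugate (free_system K k) (free_system L l) ->
    is_factor_of (free_system L l) (free_system K k).
  move=> [f [A [fA [B _ BK] [_ [g [_ _ gK]]]]]]; exists f, A; split=> //.
    by move=> h; exists (B h).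
  by move=> y; exists (g y).
have bc : is_factor_of (free_system L l) (free_system K k) -> field_isomorphic K L /\ k = l.
  by apply: factor_field_isomorphic; apply: ltnW.
have ca : field_isomorphic K L /\ k = l -> conjugate (free_system K k) (free_system L l).
  by move=> [KL <-]; apply: field_isomorphic_conjugate.
by split; [split=> [/ab|/bc/ca]|split=> [/bc|/ca/ab]].
Qed.
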